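(* Let $(M,\pi)$ be a Poisson manifold, let $c$ be a Casimir function for $\pi$, and let $\lambda\in\mathbb{R}$. For any Poisson vector fields $X,Y$ on $M$, with vertical lifts $X_V,Y_V$ to $TM$, $$\pi_{TM,X_V,Y_V,c}=\pi_{TM}+\lambda\, c(\mathbf{x})\,X_V\wedge Y_V$$ is a Poisson tensor on $TM$.
   Context: All manifolds, functions and tensors are smooth. A bivector field $P$ is a Poisson tensor if the bracket $\{f,g\}=P(df,dg)$ satisfies the Jacobi identity (equivalently, the Schouten--Nijenhuis bracket $[P,P]$ vanishes). On a Poisson manifold $(M,\pi)$ with $\{f,g\}=\pi(df,dg)$, a Casimir function is a $c\in C^\infty(M)$ with $\{\cdot,c\}=0$, and a Poisson vector field is a vector field $X$ with $\mathcal{L}_X\pi=0$. Local coordinates $\mathbf{x}=(x^1,\dots,x^N)$ on $M$ induce coordinates $(\mathbf{x},\mathbf{y})=(x^1,\dots,x^N,y^1,\dots,y^N)$ on $TM$, where $y^i$ is the fiber-wise linear function defined by $dx^i$. With $\pi^{ij}=\{x^i,x^j\}$, the Poisson tensor on $TM$ induced by $\pi$ is $$\pi_{TM}(\mathbf{x},\mathbf{y})=\sum_{i,j} \pi^{ij}(\mathbf{x})\frac{\partial}{\partial x^i}\wedge \frac{\partial}{\partial y^j}+\frac12\sum_{i,j,s}\frac{\partial\pi^{ij}}{\partial x^s}(\mathbf{x})\,y^s\frac{\partial}{\partial y^i}\wedge \frac{\partial}{\partial y^j}.$$ For $X=\sum_i v^i(\mathbf{x})\frac{\partial}{\partial x^i}$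 the vertical lift is the vector field $X_{V}=\sum_{i} v^i(\mathbf{x})\frac{\partial}{\partial y^i}$ on $TM$. The factor $c(\mathbf{x})$ on $TM$ means $c\circ q_M$, with $q_M:TM\to M$ the projection. *)

(* Defs.v *)
From HB Require Import structures.
From mathcomp Require Import all_boot all_order all_algebra.
From mathcomp Require Import boolp classical_sets functions cardinality reals.
From mathcomp Require Import interval_inference topology normedtype landau derive.

Set Implicit Arguments.
Unset Strict Implicit.
Unset Printing Implicit Defensive.

Import Order.TTheory GRing.Theory Num.Theory.
Import numFieldNormedType.Exports.

Local Open Scope classical_set_scope.
Local Open Scope ring_scope.

(* [C_on k U f] is meant for open [U]: [f] is k times Frechet differentiable
   on [U] and its k-th derivative is continuous there.  As the domain is
   finite-dimensional, the derivative [x |-> 'd f x] is C^k iff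
   [x |-> 'd f x v] is C^k for every [v]. *)
Fixpoint C_on (k : nat) (R : realType) (n : nat) (W : normedModType R)
    (U : set 'rV[R]_n) (f : 'rV[R]_n -> W) : Prop :=
  if k is k'.+1 then
    (forall x, U x -> differentiable f x) /\ (forall v, C_on k' U ('D_v f))
  else forall x, U x -> {for x, continuous f}.

Definition smooth_on (R : realType) (n : nat) (W : normedModType R)
    (U : set 'rV[R]_n) (f : 'rV[R]_n -> W) : Prop :=
  forall k, C_on k U f.

Section calculus.
Context {R : realType}.

Lemma rV_linear_continuous n (W : normedModType R) (f : {linear 'rV[R]_n -> W}) :
  continuous f.
Proof.
have -> : (f : 'rV[R]_n -> W) =
    \sum_s (fun x : 'rV[R]_n => x ord0 s *: f (delta_mx ord0 s)).
  apply/funext => x; rewrite fct_sumE {1}(row_sum_delta x) linear_sum.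
  by apply: eq_bigr => s _; rewrite linearZ.
move=> x; apply: differentiable_continuous; apply: differentiable_sum => s.
by apply: differentiableZl; exact: differentiable_coord.
Qed.

Lemma near_eq_differentiable (V W : normedModType R) (f g : V -> W) x :
  (\near x, f x = g x) -> differentiable f x -> differentiable g x.
Proof.
move=> fg df.
have E : g \o shift x = cst (g x) + 'd f x +o_ 0 id.
  have fgx := nbhs_singleton fg.
  apply/eqaddoP => _/posnumP[e].
  have /eqaddoP/(_ e%:num (gt0 e)) H := diff_locally df.
  have fg' : \forall h \near (0 : V), f (h + x) = g (h + x).
    by move: fg; rewrite (near_shift 0 x)/=; apply: filterS => h/=; rewrite subr0.
  apply: filterS2 fg' H => h Hh.
  by rewrite -[(f \o _ - _) h]/(f (h + x) - (f x + _)) Hh fgx.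
apply/diff_locallyP.
have -> : 'd g x = 'd f x :> (V -> W) by apply: diff_unique => //; exact: diff_continuous.
by split => //; exact: diff_continuous.
Qed.

Section C_on.
Context {n : nat} (U : set 'rV[R]_n) (Uo : open U).
Implicit Types W : normedModType R.

Let nearU x : U x -> \near x, U x.
Proof. by move=> Ux; apply: open_nbhs_nbhs. Qed.

Lemma C_on_ext W k (f g : 'rV[R]_n -> W) :
  (forall x, U x -> f x = g x) -> C_on k U f -> C_on k U g.
Proof.
elim: k f g => [|k IH] f g fg /=.
  move=> fc x Ux; have : g @ x --> f x; last by rewrite (fg x Ux).
  apply: cvg_trans (fc x Ux); apply: (@near_eq_cvg _ _ (nbhs x) _ f g).
  by near do apply: fg; exact: nearU.
have nfg x : U x -> \near x, f x = g x.
  by move=> Ux; near do apply: fg; exact: nearU.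
move=> [df Df]; split=> [x Ux|v].
  exact: (near_eq_differentiable (nfg x Ux) (df x Ux)).
by apply: IH (Df v) => x Ux; exact/near_eq_derive/nfg.
Unshelve. all: by end_near. Qed.

Lemma C_onW W k (f : 'rV[R]_n -> W) : C_on k.+1 U f -> C_on k U f.
Proof.
elim: k f => [|k IH] f [df Df].
  by move=> x /df; exact: differentiable_continuous.
by split=> // v; exact: IH.
Qed.

Lemma C_on_cst W k (w : W) : C_on k U (cst w : 'rV[R]_n -> W).
Proof.
elim: k w => [|k IH] w; first by move=> x _; exact: cst_continuous.
split=> [x _|v]; first exact: differentiable_cst.
by apply: C_on_ext (IH 0) => x _; rewrite derive_cst.
Qed.

Lemma C_onD W k (f g : 'rV[R]_n -> W) :
  C_on k U f -> C_on k U g -> C_on k U (f + g).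
Proof.
elim: k f g => [|k IH] f g.
  by move=> fc gc x Ux; exact: (cvgD (fc x Ux) (gc x Ux)).
move=> [df Df] [dg Dg]; split=> [x Ux|v].
  by apply: differentiableD; [exact: df|exact: dg].
apply: C_on_ext (IH _ _ (Df v) (Dg v)) => x Ux.
by rewrite deriveD//; apply: diff_derivable; [exact: df|exact: dg].
Qed.

Lemma C_on_sum W k m (f : 'I_m -> 'rV[R]_n -> W) :
  (forall i, C_on k U (f i)) -> C_on k U (\sum_i f i).
Proof.
by move=> fC; apply: big_ind => //; [exact: C_on_cst|move=> *; exact: C_onD].
Qed.

Lemma C_onM k (f g : 'rV[R]_n -> R) :
  C_on k U f -> C_on k U g -> C_on k U (f * g).
Proof.
elim: k f g => [|k IH] f g.
  by move=> fc gc x Ux; exact: (cvgM (fc x Ux) (gc x Ux)).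
move=> fC gC; have [df Df] := fC; have [dg Dg] := gC; split=> [x Ux|v].
  by apply: differentiableM; [exact: df|exact: dg].
have := C_onD (IH _ _ (C_onW fC) (Dg v)) (IH _ _ (C_onW gC) (Df v)).
apply: C_on_ext => x Ux.
by rewrite deriveM//; apply: diff_derivable; [exact: df|exact: dg].
Qed.

Lemma C_on_linear W W' k (L : {linear W -> W'}) (f : 'rV[R]_n -> W) :
  continuous L -> C_on k U f -> C_on k U (L \o f).
Proof.
move=> Lc; have dL x : differentiable L x by exact: linear_differentiable.
elim: k f => [|k IH] f.
  by move=> fc x Ux; apply: continuous_comp; [exact: fc|exact: Lc].
move=> [df Df]; split=> [x Ux|v].
  by apply: differentiable_comp; [exact: df|exact: dL].
apply: C_on_ext (IH _ (Df v)) => x Ux /=; have dfx := df x Ux.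
rewrite !deriveE//; last exact: differentiable_comp.
by rewrite [in RHS]diff_comp//= diff_lin.
Qed.

End C_on.

Lemma C_on_coord n k (U : set 'rV[R]_n) j : open U ->
  C_on k U (fun x : 'rV[R]_n => x ord0 j).
Proof.
move=> Uo; case: k => [|k]; first by move=> x _; exact: coord_continuous.
split=> [x Ux|v]; first exact: differentiable_coord.
apply: C_on_ext (C_on_cst _ k (v ord0 j)) => // x Ux.
rewrite deriveE; last exact: differentiable_coord.
have @f : {linear 'rV[R]_n -> R}.
  by exists (fun N : 'rV[R]_n => N ord0 j); do 2![eexists]; do ?[constructor];
     rewrite ?mxE// => ? *; rewrite ?mxE//; move=> ?; rewrite !mxE.
by rewrite -[fun _ => _]/(f : _ -> _) diff_lin//; exact: rV_linear_continuous.
Qed.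

Lemma C_on_comp_linear (W : normedModType R) n m k (U : set 'rV[R]_n)
    (L : {linear 'rV[R]_m -> 'rV[R]_n}) (f : 'rV[R]_n -> W) : open U ->
  C_on k U f -> C_on k (L @^-1` U) (f \o L).
Proof.
move=> Uo; have Lc : continuous L by exact: rV_linear_continuous.
have dL x : differentiable L x by exact: linear_differentiable.
have LUo : open (L @^-1` U) by apply: open_comp => // x _; exact: Lc.
elim: k f => [|k IH] f.
  by move=> fc x Ux; apply: continuous_comp; [exact: Lc|exact: fc].
move=> [df Df]; split=> [x Ux|v].
  by apply: differentiable_comp => //; exact: df.
apply: C_on_ext (IH _ (Df (L v))) => // x Ux /=.
have dfx := df (L x) Ux.
rewrite !deriveE//; last exact: differentiable_comp.
by rewrite [in RHS]diff_comp//= diff_lin.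
Qed.

Lemma C_on_entry n m k (U : set 'rV[R]_n) (f : 'rV[R]_n -> 'rV[R]_m) j :
  open U -> C_on k U f -> C_on k U (fun x => f x ord0 j).
Proof.
move=> Uo fC; have @L : {linear 'rV[R]_m -> R}.
  by exists (fun N : 'rV[R]_m => N ord0 j); do 2![eexists]; do ?[constructor];
     rewrite ?mxE// => ? *; rewrite ?mxE//; move=> ?; rewrite !mxE.
apply: (C_on_linear Uo (L := L)) fC; exact: rV_linear_continuous.
Qed.

Lemma C_onZ n m k (U : set 'rV[R]_n) (h : 'rV[R]_n -> R)
    (f : 'rV[R]_n -> 'rV[R]_m) :
  open U -> C_on k U h -> C_on k U f -> C_on k U (fun x => h x *: f x).
Proof.
move=> Uo hC fC.
have -> : (fun x => h x *: f x) = \sum_t ( *:%R^~ (delta_mx ord0 t) \o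
    (h * (fun x => f x ord0 t))).
  apply/funext => x; rewrite fct_sumE [f x in LHS]row_sum_delta scaler_sumr.
  by apply: eq_bigr => t _; rewrite scalerA.
apply: C_on_sum => // t; set e : 'rV[R]_m := delta_mx ord0 t.
have Llin : linear ( *:%R^~ e : R -> _).
  by move=> u y z; rewrite scalerDl scalerA.
pose L : {linear R -> 'rV[R]_m} :=
  HB.pack ( *:%R^~ e) (GRing.isLinear.Build _ _ _ _ _ Llin).
rewrite -[ *:%R^~ e]/(L : _ -> _).
apply: (C_on_linear Uo); first exact: scalel_continuous.
by apply: C_onM => //; exact: C_on_entry.
Qed.

End calculus.

(* A smooth atlas is recorded instead of the maximal atlas it generates; none
   of the notions below depends on the choice of atlas.  [coord i] and
   [param i] are inverse homeomorphisms between [dom i] and [cod i], with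
   unspecified values outside. *)
Record manifold (R : realType) (N : nat) := Manifold {
  carrier :> topologicalType;
  chart : Type;
  dom : chart -> set carrier;
  cod : chart -> set 'rV[R]_N;
  coord : chart -> carrier -> 'rV[R]_N;
  param : chart -> 'rV[R]_N -> carrier;
  manifold_hausdorff : hausdorff_space carrier;
  manifold_second_countable : @second_countable carrier;
  dom_cover : forall p, exists i, dom i p;
  dom_open : forall i, open (dom i);
  cod_open : forall i, open (cod i);
  coord_cod : forall i p, dom i p -> cod i (coord i p);
  param_dom : forall i x, cod i x -> dom i (param i x);
  coordK : forall i p, dom i p -> param i (coord i p) = p;
  paramK : forall i x, cod i x -> coord i (param i x) = x;
  coord_cts : forall i p, dom i p -> {for p, continuous (coord i)};
  param_cts : forall i x, cod i x -> {for x, continuous (param i)};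
  transition_smooth : forall i j,
    smooth_on (cod i `&` param i @^-1` dom j) (coord j \o param i)
}.

(* With the row-vector convention of ['J], the entry (a, b) is
   d x_j^b / d x_i^a at p. *)
Definition transition_jacobian (R : realType) (N : nat) (M : manifold R N)
    (i j : chart M) (p : M) : 'M[R]_N :=
  'J (coord j \o param i) (coord i p).

(* A tangent vector is the family of its components in all the charts around
   its foot point; the value 0 in the other charts makes equality of tangent
   vectors extensional. *)
Record tangent_vector (R : realType) (N : nat) (M : manifold R N) :=
  TangentVector {
    foot : M;
    velocity : chart M -> 'rV[R]_N;
    velocity_out : forall i, ~ dom i foot -> velocity i = 0;
    velocity_law : forall i j, dom i foot -> dom j foot ->
      velocity j = velocity i *m transition_jacobian i j foot
  }.

Lemma mul_rV_inj (R : pzRingType) m n (A B : 'M[R]_(m, n)) :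
  (forall v : 'rV_m, v *m A = v *m B) -> A = B.
Proof. by move=> AB; apply/row_matrixP => a; rewrite !rowE. Qed.

Section tangent_bundle.
Context {R : realType} {N : nat} (M : manifold R N).
Implicit Types (i j k : chart M) (p : M) (u : tangent_vector M).

Local Notation overlap i j := (cod i `&` param i @^-1` dom j).
Local Notation T := transition_jacobian.

Lemma overlap_open i j : open (overlap i j).
Proof.
rewrite openE => x [ci dj]; apply: filterI.
  by apply: open_nbhs_nbhs; split => //; exact: cod_open.
by apply: (param_cts ci); apply: open_nbhs_nbhs; split => //; exact: dom_open.
Qed.

Lemma overlap_coord i j p : dom i p -> dom j p -> overlap i j (coord i p).
Proof. by move=> pi pj; split=> /=; [exact: coord_cod|rewrite coordK]. Qed.

Lemma transition_differentiable i j x : overlap i j x ->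
  differentiable (coord j \o param i) x.
Proof. by move=> xO; have [+ _] := transition_smooth i j 1; exact. Qed.

Lemma transition_cocycle i j k p : dom i p -> dom j p -> dom k p ->
  T i k p = T i j p *m T j k p.
Proof.
move=> pi pj pk; apply: mul_rV_inj => v; rewrite mulmxA.
have dij := transition_differentiable (overlap_coord pi pj).
have djk := transition_differentiable (overlap_coord pj pk).
have dik := transition_differentiable (overlap_coord pi pk).
have Ep : (coord j \o param i) (coord i p) = coord j p by rewrite /= coordK.
transitivity ('D_v (coord k \o param i) (coord i p)).
  exact/esym/deriveEjacobian.
transitivity
  ('D_v ((coord k \o param j) \o (coord j \o param i)) (coord i p)).
  apply: near_eq_derive; near=> x => /=.
  have : overlap i j x; last by case=> _ xj; rewrite coordK.
  near: x; apply: open_nbhs_nbhs.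
  by split; [exact: overlap_open|exact: overlap_coord].
have djk' : differentiable (coord k \o param j) ((coord j \o param i) (coord i p)).
  by rewrite Ep.
have dji := differentiable_comp dij djk'.
transitivity ('d (coord k \o param j) (coord j p) ('d (coord j \o param i) (coord i p) v)).
  rewrite (deriveE v dji).
  have := congr1 (@^~ v) (diff_comp dij djk').
  by rewrite Ep.
have E := etrans (esym (deriveE v dij)) (deriveEjacobian v dij).
apply: etrans (congr1 ('d (coord k \o param j) (coord j p)) E) _.
exact: etrans (esym (deriveE _ djk)) (deriveEjacobian _ djk).
Unshelve. all: by end_near. Qed.

Lemma transition_id i p : dom i p -> T i i p = 1%:M.
Proof.
move=> pi; apply: mul_rV_inj => v; rewrite mulmx1.
have dii := transition_differentiable (overlap_coord pi pi).
rewrite -(deriveEjacobian _ dii) -[RHS](derive_id (coord i p)); apply: near_eq_derive.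
near=> x => /=; rewrite paramK//; near: x.
by apply: open_nbhs_nbhs; split; [exact: cod_open|exact: coord_cod].
Unshelve. all: by end_near. Qed.

Lemma tangent_eq u v : foot u = foot v ->
  (forall i, dom i (foot u) -> velocity u i = velocity v i) -> u = v.
Proof.
case: u v => [p a a0 aT] [q b b0 bT] /= pq; case: _ / pq b0 bT => b0 bT ab.
have E : a = b.
  apply/funext => i; case: (pselect (dom i p)) => [/ab//|ip].
  by rewrite a0// b0.
by case: _ / E b0 bT {ab} => b0 bT; congr TangentVector; exact: Prop_irrelevance.
Qed.

(* Components in chart [j] of the vector at [p] with components [w] in
   chart [i]. *)
Definition transported i p (w : 'rV[R]_N) j : 'rV[R]_N :=
  if `[< dom i p /\ dom j p >] then w *m T i j p else 0.

Lemma transported_out i p w j : ~ dom j p -> transported i p w j = 0.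
Proof. by rewrite /transported; case: asboolP => // -[]. Qed.

Lemma transported_law i p w j k : dom j p -> dom k p ->
  transported i p w k = transported i p w j *m T j k p.
Proof.
rewrite /transported => pj pk; case: (pselect (dom i p)) => pi.
  rewrite (asboolT (conj pi pj)) (asboolT (conj pi pk)) -mulmxA.
  by congr (_ *m _); exact: transition_cocycle.
have nij : ~ (dom i p /\ dom j p) by case.
have nik : ~ (dom i p /\ dom k p) by case.
by rewrite (asboolF nij) (asboolF nik) mul0mx.
Qed.

Definition tangent_of i p (w : 'rV[R]_N) : tangent_vector M :=
  TangentVector (@transported_out i p w) (@transported_law i p w).

Lemma velocity_tangent_of i p w j : dom i p -> dom j p ->
  velocity (tangent_of i p w) j = w *m T i j p.
Proof. by move=> pi pj; rewrite /= /transported (asboolT (conj pi pj)). Qed.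

(* Chart [i] of the base induces the chart (x, y) of the tangent bundle, where
   x is [lsubmx] and y is [rsubmx] of a row of size N + N. *)
Definition tdom i : set (tangent_vector M) := [set u | dom i (foot u)].
Definition tcod i : set 'rV[R]_(N + N) := [set z | cod i (lsubmx z)].
Definition tcoord i u : 'rV[R]_(N + N) := row_mx (coord i (foot u)) (velocity u i).
Definition tparam i (z : 'rV[R]_(N + N)) : tangent_vector M :=
  tangent_of i (param i (lsubmx z)) (rsubmx z).

Lemma lsub_open n (A : set 'rV[R]_n) : open A ->
  open [set z : 'rV[R]_(n + n) | A (lsubmx z)].
Proof. by move=> Ao; apply: open_comp => // z _; exact: continuous_lsubmx. Qed.

Lemma tcod_open i : open (tcod i).
Proof. by apply: lsub_open; exact: cod_open. Qed.

Lemma tcoord_cod i u : tdom i u -> tcod i (tcoord i u).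
Proof. by move=> ui; rewrite /tcod/= row_mxKl; exact: coord_cod. Qed.

Lemma tparam_dom i z : tcod i z -> tdom i (tparam i z).
Proof. by move=> /param_dom. Qed.

Lemma tcoordK i u : tdom i u -> tparam i (tcoord i u) = u.
Proof.
move=> ui; rewrite /tparam row_mxKl row_mxKr coordK//.
apply: tangent_eq => // j uj.
by rewrite velocity_tangent_of// -(velocity_law ui uj).
Qed.

Lemma tparamK i z : tcod i z -> tcoord i (tparam i z) = z.
Proof.
move=> zi; rewrite /tcoord [foot _]/=.
rewrite velocity_tangent_of; [|exact: param_dom..].
by rewrite transition_id ?mulmx1 ?paramK ?hsubmxK//; exact: param_dom.
Qed.

Lemma toverlap_open i j : open (tcod i `&` tparam i @^-1` tdom j).
Proof.
rewrite (_ : _ `&` _ = [set z | overlap i j (lsubmx z)])//.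
by apply: lsub_open; exact: overlap_open.
Qed.

Lemma ttransition_smooth i j :
  smooth_on (tcod i `&` tparam i @^-1` tdom j) (tcoord j \o tparam i).
Proof.
move=> k; have Oo : open (overlap i j) by exact: overlap_open.
rewrite (_ : _ `&` _ = (@lsubmx R 1 N N) @^-1` overlap i j)//.
set O := _ @^-1` _; have tOo : open O by exact: lsub_open.
pose f := coord j \o param i.
pose inl : 'M[R]_(N, N + N) := row_mx 1%:M 0.
pose inr : 'M[R]_(N, N + N) := row_mx 0 1%:M.
pose G (z : 'rV[R]_(N + N)) :=
  \sum_s z ord0 (rshift N s) *: 'D_(delta_mx ord0 s) f (lsubmx z).
have GC : C_on k O G.
  rewrite (_ : G = \sum_s (fun z : 'rV[R]_(N + N) =>
      z ord0 (rshift N s) *: 'D_(delta_mx ord0 s) f (lsubmx z))); last first.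
    by apply/funext => z; rewrite fct_sumE.
  apply: C_on_sum => // s; apply: C_onZ => //; first exact: C_on_coord.
  apply: (C_on_comp_linear _ (f := 'D_(delta_mx ord0 s) f)) => //.
  by have [_] := transition_smooth i j k.+1; exact.
have fC : C_on k O (f \o lsubmx).
  by apply: C_on_comp_linear => //; exact: transition_smooth.
have := C_onD tOo
  (C_on_linear tOo (@rV_linear_continuous R _ _ (mulmxr inl)) fC)
  (C_on_linear tOo (@rV_linear_continuous R _ _ (mulmxr inr)) GC).
apply: C_on_ext => // z zO.
have [zi zj] := zO.
have pi : dom i (param i (lsubmx z)) by exact: param_dom.
rewrite -[LHS]/(f (lsubmx z) *m inl + G z *m inr) !mul_mx_row !mulmx1 !mulmx0.
rewrite add_row_mx addr0 add0r /= /tcoord [foot _]/= velocity_tangent_of//.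
congr row_mx; rewrite /transition_jacobian paramK//.
have df := transition_differentiable zO.
apply: etrans _ (deriveEjacobian _ df); apply: etrans _ (esym (deriveE _ df)).
rewrite /G [rsubmx z in RHS]row_sum_delta linear_sum; apply: eq_bigr => s _.
by rewrite linearZ/= mxE; congr (_ *: _); exact: deriveE.
Qed.

(* The topology for which the maps [tcoord i] are homeomorphisms from the open
   sets [tdom i] onto [tcod i]. *)
Definition topen (A : set (tangent_vector M)) :=
  forall i, open (tcod i `&` tparam i @^-1` A).

Lemma topenT : topen setT.
Proof. by move=> i; rewrite preimage_setT setIT; exact: tcod_open. Qed.

Lemma topenI : setI_closed topen.
Proof.
by move=> A B Ao Bo i; rewrite preimage_setI setIIr; apply: openI.
Qed.

Lemma topen_bigU (I : Type) (f : I -> set (tangent_vector M)) :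
  (forall a, topen (f a)) -> topen (\bigcup_a f a).
Proof.
move=> fo i; rewrite preimage_bigcup setI_bigcupr.
by apply: bigcup_open => a _; exact: fo.
Qed.

HB.instance Definition _ := gen_eqMixin (tangent_vector M).
HB.instance Definition _ := gen_choiceMixin (tangent_vector M).
HB.instance Definition _ :=
  isOpenTopological.Build (tangent_vector M) topenT topenI topen_bigU.

End tangent_bundle.

Lemma rV_second_countable (R : realType) n : @second_countable 'rV[R]_n.
Proof.
pose b (qk : 'rV[rat]_n * nat) : set 'rV[R]_n :=
  ball (map_mx (@ratr R) qk.1) qk.2.+1%:R^-1.
exists (range b).
  apply: sub_countable (card_image_le _ _) _; exact: countableP.
split=> [_ [qk _ <-]|x A]; first exact: ball_open.
rewrite nbhs_simpl/= => /nbhs_ballP[e /= e0 xA].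
have [k ke] : exists k : nat, k.+1%:R^-1 < e / 2.
  exists (Num.truncn (e / 2)^-1).
  rewrite invf_plt ?posrE ?divr_gt0// ?ltr0n//.
  exact: truncnS_gt.
have k0 : 0 < k.+1%:R^-1 :> R by rewrite invr_gt0 ltr0n.
have qP (j : 'I_n) : exists q : rat, `|x ord0 j - ratr q| < k.+1%:R^-1.
  have [|q] := @rat_in_itvoo R (x ord0 j - k.+1%:R^-1) (x ord0 j + k.+1%:R^-1).
    by rewrite ltrD2l gtrN.
  by rewrite in_itv/= => /andP[xq qx]; exists q; rewrite ltr_distlC xq.
pose q : 'rV[rat]_n := \row_j projT1 (cid (qP j)).
have xq : ball x k.+1%:R^-1 (map_mx (@ratr R) q).
  split=> // a j; rewrite ord1 !mxE; exact: projT2 (cid (qP j)).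
exists (b (q, k)); first by split; [exists (q, k)|exact/ball_sym].
move=> y qy; apply: xA; rewrite [e]splitr.
by apply: (@ball_triangle _ _ (map_mx (@ratr R) q)); exact: le_ball (ltW ke) _ _.
Qed.

Section tangent_bundle_manifold.
Context {R : realType} {N : nat} (M : manifold R N).
Implicit Types (i j : chart M) (u v : tangent_vector M).

Lemma open_tangentE (A : set (tangent_vector M)) : open A = topen A.
Proof. by []. Qed.

Lemma foot_open (A : set M) : open A -> open (@foot R N M @^-1` A).
Proof.
move=> Ao; rewrite open_tangentE => i.
have cAo : open (cod i `&` param i @^-1` A).
  rewrite openE => x [ci dA]; apply: filterI.
    by apply: open_nbhs_nbhs; split => //; exact: cod_open.
  by apply: (param_cts ci); exact: open_nbhs_nbhs.
exact: lsub_open cAo.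
Qed.

Lemma tdom_open i : open (tdom i).
Proof. by apply: foot_open; exact: dom_open. Qed.

Lemma tcoord_open i (B : set 'rV[R]_(N + N)) : open B ->
  open (tdom i `&` @tcoord R N M i @^-1` B).
Proof.
move=> Bo; rewrite open_tangentE => j.
rewrite openE => z [zj [zi zB]].
have oz : (tcod j `&` tparam j @^-1` tdom i) z by [].
have tc : {for z, continuous (@tcoord R N M i \o @tparam R N M j)}.
  exact: (@ttransition_smooth R N M j i 0%N).
have {tc}H := tc B (open_nbhs_nbhs (conj Bo zB)).
have H' := open_nbhs_nbhs (conj (@toverlap_open R N M j i) oz).
apply: (@filterS2 _ (nbhs z) _ _ _ _ _ H H') => y yB [yj yi].
by [].
Qed.

Lemma tcoord_cts i u : tdom i u -> {for u, continuous (tcoord i)}.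
Proof.
move=> ui B; rewrite nbhsE => -[B' [B'o uB'] B'B].
apply: (@filterS _ _ _ (tdom i `&` @tcoord R N M i @^-1` B')).
  by move=> v [_ /B'B].
by apply: open_nbhs_nbhs; split=> //; exact: tcoord_open.
Qed.

Lemma tparam_cts i z : tcod i z -> {for z, continuous (@tparam R N M i)}.
Proof.
move=> zi A; rewrite nbhsE => -[A' [A'o uA'] A'A].
apply: (@filterS _ _ _ (tcod i `&` @tparam R N M i @^-1` A')).
  by move=> v [_ /A'A].
by apply: open_nbhs_nbhs; split=> //; exact: A'o.
Qed.

Lemma tangent_hausdorff : hausdorff_space (tangent_vector M).
Proof.
rewrite open_hausdorff => u v uv.
have [fuv|fuv] := eqVneq (foot u) (foot v); last first.
  have := @manifold_hausdorff R N M; rewrite open_hausdorff.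
  move=> /(_ _ _ fuv)[[A B]/= [uA vB] [Ao Bo AB0]].
  exists (@foot R N M @^-1` A, @foot R N M @^-1` B) => /=.
    by split; rewrite inE/=; exact: set_mem.
  split; [exact: foot_open|exact: foot_open|].
  by rewrite -preimage_setI (eqP AB0) preimage_set0.
have [i ui] := dom_cover (foot u).
have vi : dom i (foot v) by rewrite -fuv.
have tuv : tcoord i u != tcoord i v.
  apply: contra uv => /eqP E; apply/eqP.
  by rewrite -(tcoordK ui) -(tcoordK vi) E.
have := @norm_hausdorff _ 'rV[R]_(N + N); rewrite open_hausdorff.
move=> /(_ _ _ tuv)[[A B]/= [uA vB] [Ao Bo AB0]].
exists (tdom i `&` @tcoord R N M i @^-1` A, tdom i `&` @tcoord R N M i @^-1` B) => /=.
  by split; rewrite inE/=; split => //; exact: set_mem.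
split; [exact: tcoord_open|exact: tcoord_open|].
by rewrite setIACA setIid -preimage_setI (eqP AB0) preimage_set0 setI0.
Qed.

Lemma tangent_second_countable : @second_countable (tangent_vector M).
Proof.
have [BM cBM [BMo BMb]] := @manifold_second_countable R N M.
have [BV cBV [BVo BVb]] := rV_second_countable R (N + N).
pose S (UW : set M * set 'rV[R]_(N + N)) : set (tangent_vector M) :=
  match pselect (exists i, UW.1 `<=` dom i) with
  | left h => @foot R N M @^-1` UW.1 `&`
      (tdom (projT1 (cid h)) `&` @tcoord R N M (projT1 (cid h)) @^-1` UW.2)
  | right _ => set0
  end.
exists (S @` (BM `*` BV)).
  by apply: sub_countable (card_image_le _ _) _; exact: countableX.
split=> [_ [[U W] [/= /BMo Uo /BVo Wo] <-]|u A].
  rewrite /S; case: pselect => [h|_]; last exact: open0.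
  by apply: openI; [exact: foot_open|exact: tcoord_open].
rewrite nbhs_simpl/= nbhsE => -[A' [A'o uA'] A'A].
have [i ui] := dom_cover (foot u).
have [U [BU uU] Ui] : filter_from [set U | BM U /\ U (foot u)] id (dom i).
  by apply: BMb; apply: open_nbhs_nbhs; split=> //; exact: dom_open.
have h : exists i, U `<=` dom i by exists i.
pose l := projT1 (cid h); have Ul : U `<=` dom l := projT2 (cid h).
have ul : tdom l u := Ul _ uU.
have [W [BW uW] WA] : filter_from [set W | BV W /\ W (tcoord l u)] id
    (tcod l `&` @tparam R N M l @^-1` A').
  apply: BVb; apply: open_nbhs_nbhs; split; first exact: A'o.
  by split; [exact: tcoord_cod|rewrite /= tcoordK].
have SE : S (U, W) =
    @foot R N M @^-1` U `&` (tdom l `&` @tcoord R N M l @^-1` W).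
  by rewrite /S /=; case: pselect => // h'; rewrite (Prop_irrelevance h' h).
exists (S (U, W)); last first.
  rewrite SE => v [vU [vl vW]]; apply: A'A.
  by have [_ /=] := WA _ vW; rewrite tcoordK.
split; first by exists (U, W).
by rewrite SE.
Qed.

Definition tangent_bundle : manifold R (N + N) :=
  @Manifold R (N + N) (tangent_vector M) (chart M) (@tdom R N M) (@tcod R N M)
    (@tcoord R N M) (@tparam R N M) tangent_hausdorff tangent_second_countable
    (fun u => dom_cover (foot u)) tdom_open (@tcod_open R N M)
    (@tcoord_cod R N M) (@tparam_dom R N M) (@tcoordK R N M) (@tparamK R N M)
    tcoord_cts tparam_cts (@ttransition_smooth R N M).

End tangent_bundle_manifold.

Section functions_and_tensors.
Context {R : realType} {N : nat} (M : manifold R N).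
Implicit Types (i j : chart M) (p : M) (f g h : M -> R).

Definition smooth_function f := forall i, smooth_on (cod i) (f \o param i).

(* Tensor fields are given by their components in every chart; the values at
   points outside the domain of the chart are irrelevant. *)
Definition vector_components := chart M -> M -> 'rV[R]_N.
Definition bivector_components := chart M -> M -> 'M[R]_N.

Definition is_vector_field (X : vector_components) :=
  (forall i j p, dom i p -> dom j p ->
     X j p = X i p *m transition_jacobian i j p) /\
  (forall i, smooth_on (cod i) (X i \o param i)).

Definition is_bivector_field (P : bivector_components) :=
  [/\ forall i p, dom i p -> (P i p)^T = - P i p,
      forall i j p, dom i p -> dom j p ->
        P j p = (transition_jacobian i j p)^T *m P i p
                  *m transition_jacobian i j p
    & forall i, smooth_on (cod i) (P i \o param i)].

Definition partial i (a : 'I_N) f p : R :=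
  'D_(delta_mx ord0 a) (f \o param i) (coord i p).

(* P(df, dg) at [p], computed in chart [i]. *)
Definition bracket_in (P : bivector_components) i f g p : R :=
  \sum_a \sum_b P i p a b * partial i a f p * partial i b g p.

Definition chart_at p : chart M := projT1 (cid (dom_cover p)).

(* The choice of the chart around [p] is immaterial, see [bracketE]. *)
Definition bracket (P : bivector_components) f g p : R :=
  bracket_in P (chart_at p) f g p.

Definition is_poisson_tensor (P : bivector_components) :=
  is_bivector_field P /\
  forall f g h, smooth_function f -> smooth_function g -> smooth_function h ->
    forall p, bracket P f (bracket P g h) p + bracket P g (bracket P h f) p
              + bracket P h (bracket P f g) p = 0.

Definition is_casimir (P : bivector_components) (c : M -> R) :=
  smooth_function c /\
  forall f, smooth_function f -> forall p, bracket P f c p = 0.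

(* (L_X P)^{ab} = X^k d_k P^{ab} - P^{kb} d_k X^a - P^{ak} d_k X^b, the
   Jacobian having entries d_k X^a in row k and column a. *)
Definition lie_derivative (X : vector_components) (P : bivector_components) :
    bivector_components := fun i p =>
  let J := 'J (X i \o param i) (coord i p) in
  'D_(X i p) (P i \o param i) (coord i p) - J^T *m P i p - P i p *m J.

Definition is_poisson_vector_field (P : bivector_components)
    (X : vector_components) :=
  is_vector_field X /\ forall i p, dom i p -> lie_derivative X P i p = 0.

Lemma partial_transition i j a f p : smooth_function f ->
  dom i p -> dom j p ->
  partial i a f p = \sum_b transition_jacobian i j p a b * partial j b f p.
Proof.
move=> fs pi pj.
have dij := transition_differentiable (overlap_coord pi pj).
have dfj : differentiable (f \o param j) (coord j p).
  by have [+ _] := fs j 1%N; apply; exact: coord_cod.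
have Ep : (coord j \o param i) (coord i p) = coord j p by rewrite /= coordK.
have dfj' : differentiable (f \o param j) ((coord j \o param i) (coord i p)).
  by rewrite Ep.
pose e : 'rV[R]_N := delta_mx ord0 a.
transitivity ('D_e ((f \o param j) \o (coord j \o param i)) (coord i p)).
  apply: near_eq_derive; near=> x => /=.
  have : (cod i `&` param i @^-1` dom j) x; last by case=> _ xj; rewrite coordK.
  near: x; apply: open_nbhs_nbhs.
  by split; [exact: overlap_open|exact: overlap_coord].
apply: etrans (deriveE e (differentiable_comp dij dfj')) _.
apply: etrans (congr1 (@^~ e) (diff_comp dij dfj')) _; rewrite Ep.
have E := etrans (esym (deriveE e dij)) (deriveEjacobian e dij).
apply: etrans (congr1 ('d (f \o param j) (coord j p)) E) _.
rewrite -rowE -/(transition_jacobian i j p) [row a _]row_sum_delta linear_sum.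
apply: eq_bigr => b _; rewrite linearZ/= mxE; congr (_ * _).
exact/esym/deriveE.
Unshelve. all: by end_near. Qed.

Lemma bracketE (P : bivector_components) f g i p :
  is_bivector_field P -> smooth_function f -> smooth_function g -> dom i p ->
  bracket P f g p = bracket_in P i f g p.
Proof.
move=> [_ Ptr _] fs gs pi; rewrite /bracket; set j := chart_at p.
have pj : dom j p := projT2 (cid (dom_cover p)).
have bE k : bracket_in P k f g p = ((\col_a partial k a f p)^T *m P k p
    *m \col_b partial k b g p) ord0 ord0.
  rewrite /bracket_in !mxE exchange_big; apply: eq_bigr => b _ /=.
  rewrite !mxE mulr_suml; apply: eq_bigr => a _.
  by rewrite !mxE; congr (_ * _); exact: mulrC.
have pE h : smooth_function h -> \col_a partial i a h p =
    transition_jacobian i j p *m \col_b partial j b h p.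
  move=> hs; apply/colP => a; rewrite !mxE (partial_transition a hs pi pj).
  by apply: eq_bigr => b _; congr (_ * _); rewrite mxE.
by rewrite !bE (pE f fs) (pE g gs) (Ptr i j p pi pj) trmx_mul !mulmxA.
Qed.

End functions_and_tensors.

(* Normalized so that d/dx /\ d/dy takes the value 1 on (dx, dy), as required
   by pi = 1/2 \sum_(a, b) pi^{ab} d/dx^a /\ d/dx^b with pi^{ab} = {x^a, x^b}. *)
Definition wedge (R : realType) (n : nat) (u v : 'rV[R]_n) : 'M[R]_n :=
  u^T *m v - v^T *m u.

Section lifts.
Context {R : realType} {N : nat} (M : manifold R N).

Definition bundle_proj : tangent_bundle M -> M := @foot R N M.

Definition basis_x (a : 'I_N) : 'rV[R]_(N + N) := delta_mx ord0 (lshift N a).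
Definition basis_y (a : 'I_N) : 'rV[R]_(N + N) := delta_mx ord0 (rshift N a).

Definition tangent_lift (P : bivector_components M) :
    bivector_components (tangent_bundle M) :=
  fun (i : chart M) (u : tangent_vector M) =>
  \sum_a \sum_b P i (foot u) a b *: wedge (basis_x a) (basis_y b)
  + 2^-1 *: \sum_a \sum_b \sum_s
      (partial i s (fun q => P i q a b) (foot u) * velocity u i ord0 s)
        *: wedge (basis_y a) (basis_y b).

Definition vertical_lift (X : vector_components M) :
    vector_components (tangent_bundle M) :=
  fun (i : chart M) (u : tangent_vector M) =>
  \sum_a X i (foot u) ord0 a *: basis_y a.

End lifts.

(* Main.v *)
From HB Require Import structures.
From mathcomp Require Import all_boot all_order all_algebra.
From mathcomp Require Import boolp classical_sets functions reals.
From mathcomp Require Import interval_inference topology normedtype landau derive.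
From mathcomp Require Import sequences realfun exp.
From mathcomp Require Import ring.
Require Import Defs.

(** In the chart [(x, y)] of the tangent bundle induced by a chart of [M], let
    [A] be the matrix of [pi], let [k] be [lambda] times [c], and let [X], [Y]
    be the components of the vector fields.  The deformed tensor has the block
    matrix [lifted A k X Y]: zero upper left block, off-diagonal blocks [A x],
    and lower right block ['D_y A x + k x *: wedge (X x) (Y x)].

    The Jacobi identity is first turned into an identity of matrices.  For a
    skew [A], the cyclic sum of [{f, {g, h}}] depends on the differentials of
    [f], [g], [h] only, by symmetry of second derivatives, and equals the
    trilinear [jacobiator] of [A] at these covectors.  Conversely every covector
    at a point is the differential of a global smooth function: a linear
    function in a chart is cut off by a bump function.  So a bivector field is
    Poisson iff its jacobiator vanishes in every chart ([poisson_tensorP]), and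
    the Casimir condition says that [c] is constant along the directions
    [u *m A x] ([casimir_local]).

    Evaluated on three covectors of the tangent bundle, the jacobiator of
    [lifted A k X Y] splits ([jacobiator_term_lifted], [lifted_jacobi]) into
    - three jacobiators of [A] at [x], which vanish;
    - the derivative along [y] of a jacobiator of [A], which vanishes because
      the jacobiator of [A] is zero on an open set;
    - derivatives of [k] along directions [u *m A x], which vanish because [c]
      is a Casimir function;
    - [k x] times the Schouten bracket of [pi] with [X /\ Y], which vanishes
      because the Lie derivatives of [pi] along [X] and [Y] do
      ([schouten_wedge]).

    That the block matrices are the components of a bivector field comes from
    the fact that a chart change of the tangent bundle is the tangent map of a
    chart change of [M] ([tangent_transition]): differentiating the
    transformation law of [A] along [y] gives the one of the lower right block
    ([lifted_transition]).

    Covectors are row vectors and the matrix fields are differentiated as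
    matrix-valued maps along arbitrary directions, so that hardly any indices
    appear. *)

Set Implicit Arguments.
Unset Strict Implicit.
Unset Printing Implicit Defensive.

Import Order.TTheory GRing.Theory Num.Theory.
Import numFieldNormedType.Exports.

Local Open Scope classical_set_scope.
Local Open Scope ring_scope.

(** * Differential calculus of matrix-valued maps *)

Section pointwise.
Context {R : realType} {V : normedModType R}.

Lemma derivable_entry m n (f : V -> 'M[R]_(m, n)) x v a b :
  derivable f x v -> derivable (fun y => f y a b) x v.
Proof. by move=> /derivable_mxP. Qed.

Lemma derive_entry m n (f : V -> 'M[R]_(m, n)) x v a b :
  derivable f x v -> ('D_v f x) a b = 'D_v (fun y => f y a b) x.
Proof. by move=> df; rewrite derive_mx// mxE. Qed.

Lemma derivable_mulmx m n p (f : V -> 'M[R]_(m, n)) (g : V -> 'M[R]_(n, p)) x v :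
  derivable f x v -> derivable g x v -> derivable (fun y => f y *m g y) x v.
Proof.
move=> df dg; apply/derivable_mxP => a b.
have -> : (fun y => (f y *m g y) a b) =
    \sum_c ((fun y => f y a c) * (fun y => g y c b)).
  by apply/funext => y; rewrite fct_sumE mxE.
by apply: derivable_sum => c; apply: derivableM; exact: derivable_entry.
Qed.

Lemma derive_mulmx m n p (f : V -> 'M[R]_(m, n)) (g : V -> 'M[R]_(n, p)) x v :
  derivable f x v -> derivable g x v ->
  'D_v (fun y => f y *m g y) x = 'D_v f x *m g x + f x *m 'D_v g x.
Proof.
move=> df dg; rewrite derive_mx; last exact: derivable_mulmx.
apply/matrixP => a b; rewrite !mxE -big_split/=.
have -> : (fun y => (f y *m g y) a b) =
    \sum_c ((fun y => f y a c) * (fun y => g y c b)).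
  by apply/funext => y; rewrite fct_sumE mxE.
rewrite derive_sum; last first.
  by move=> c; apply: derivableM; exact: derivable_entry.
apply: eq_bigr => c _; rewrite deriveM; [|exact: derivable_entry..].
rewrite (derive_entry _ _ df) (derive_entry _ _ dg) addrC.
by congr (_ + _); exact: mulrC.
Qed.

Lemma derivable_trmx m n (f : V -> 'M[R]_(m, n)) x v :
  derivable f x v -> derivable (fun y => (f y)^T) x v.
Proof.
move=> /derivable_mxP df; apply/derivable_mxP => a b.
by under eq_fun do rewrite mxE; exact: df.
Qed.

Lemma derive_trmx m n (f : V -> 'M[R]_(m, n)) x v :
  derivable f x v -> 'D_v (fun y => (f y)^T) x = ('D_v f x)^T.
Proof.
move=> df; rewrite !derive_mx//; last exact: derivable_trmx.
by apply/matrixP => a b; rewrite !mxE; under eq_fun do rewrite mxE.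
Qed.

Lemma derive_cmulmx m n p (A : 'M[R]_(m, n)) (g : V -> 'M[R]_(n, p)) x v :
  derivable g x v -> 'D_v (fun y => A *m g y) x = A *m 'D_v g x.
Proof.
move=> dg; rewrite (derive_mulmx (derivable_cst A x v))//.
by rewrite derive_cst mul0mx add0r.
Qed.

Lemma derive_mulmxc m n p (f : V -> 'M[R]_(m, n)) (B : 'M[R]_(n, p)) x v :
  derivable f x v -> 'D_v (fun y => f y *m B) x = 'D_v f x *m B.
Proof.
move=> df; rewrite (derive_mulmx df (derivable_cst B x v)).
by rewrite derive_cst mulmx0 addr0.
Qed.

Lemma derivable_scalemx m p (f : V -> R)
    (g : V -> 'M[R]_(m, p)) x v : derivable f x v -> derivable g x v ->
  derivable (fun y => f y *: g y) x v.
Proof.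
move=> df dg; apply/derivable_mxP => a b; under eq_fun do rewrite mxE.
have dgab : derivable (fun y => g y a b) x v by exact: derivable_entry.
exact: (derivableM df dgab).
Qed.

Lemma derive_scalemx m p (f : V -> R)
    (g : V -> 'M[R]_(m, p)) x v : derivable f x v -> derivable g x v ->
  'D_v (fun y => f y *: g y) x = 'D_v f x *: g x + f x *: 'D_v g x.
Proof.
move=> df dg; rewrite derive_mx; last exact: derivable_scalemx.
apply/matrixP => a b; rewrite !mxE; under eq_fun do rewrite mxE.
have dgab : derivable (fun y => g y a b) x v by exact: derivable_entry.
apply: etrans (deriveM df dgab) _; rewrite (derive_entry _ _ dg) addrC.
by congr (_ + _); exact: mulrC.
Qed.

Lemma derivable_block_mx m1 m2 n1 n2
    (a : V -> 'M[R]_(m1, n1)) (b : V -> 'M[R]_(m1, n2))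
    (c : V -> 'M[R]_(m2, n1)) (d : V -> 'M[R]_(m2, n2)) x v :
  derivable a x v -> derivable b x v -> derivable c x v -> derivable d x v ->
  derivable (fun y => block_mx (a y) (b y) (c y) (d y)) x v.
Proof.
move=> da db dc dd; apply/derivable_mxP => i j.
case: (split_ordP i) => k ->; case: (split_ordP j) => l ->.
- by under eq_fun do rewrite block_mxEul; exact: derivable_entry.
- by under eq_fun do rewrite block_mxEur; exact: derivable_entry.
- by under eq_fun do rewrite block_mxEdl; exact: derivable_entry.
- by under eq_fun do rewrite block_mxEdr; exact: derivable_entry.
Qed.

Lemma derive_block_mx m1 m2 n1 n2
    (a : V -> 'M[R]_(m1, n1)) (b : V -> 'M[R]_(m1, n2))
    (c : V -> 'M[R]_(m2, n1)) (d : V -> 'M[R]_(m2, n2)) x v :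
  derivable a x v -> derivable b x v -> derivable c x v -> derivable d x v ->
  'D_v (fun y => block_mx (a y) (b y) (c y) (d y)) x =
  block_mx ('D_v a x) ('D_v b x) ('D_v c x) ('D_v d x).
Proof.
move=> da db dc dd; apply/matrixP => i j.
rewrite derive_entry; last exact: derivable_block_mx.
case: (split_ordP i) => k ->; case: (split_ordP j) => l ->.
- by under eq_fun do rewrite block_mxEul; rewrite block_mxEul derive_entry.
- by under eq_fun do rewrite block_mxEur; rewrite block_mxEur derive_entry.
- by under eq_fun do rewrite block_mxEdl; rewrite block_mxEdl derive_entry.
- by under eq_fun do rewrite block_mxEdr; rewrite block_mxEdr derive_entry.
Qed.

Lemma derive_row_mx m n1 n2
    (a : V -> 'M[R]_(m, n1)) (b : V -> 'M[R]_(m, n2)) x v :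
  derivable a x v -> derivable b x v ->
  'D_v (fun y => row_mx (a y) (b y)) x = row_mx ('D_v a x) ('D_v b x).
Proof.
move=> da db.
have d : derivable (fun y => row_mx (a y) (b y)) x v.
  apply/derivable_mxP => i j; case: (split_ordP j) => l ->.
    by under eq_fun do rewrite row_mxEl; exact: derivable_entry.
  by under eq_fun do rewrite row_mxEr; exact: derivable_entry.
apply/matrixP => i j; rewrite (derive_entry _ _ d).
case: (split_ordP j) => l ->.
  by under eq_fun do rewrite row_mxEl; rewrite row_mxEl derive_entry.
by under eq_fun do rewrite row_mxEr; rewrite row_mxEr derive_entry.
Qed.

Lemma derive_dirD (W : normedModType R) (f : V -> W) x u v :
  differentiable f x -> 'D_(u + v) f x = 'D_u f x + 'D_v f x.
Proof. by move=> df; rewrite !deriveE// linearD. Qed.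

Lemma derive_dirZ (W : normedModType R) (f : V -> W) x a v :
  differentiable f x -> 'D_(a *: v) f x = a *: 'D_v f x.
Proof. by move=> df; rewrite !deriveE// linearZ. Qed.

Lemma derive_comp (V' W : normedModType R) (g : V -> V') (f : V' -> W) x v :
  differentiable g x -> differentiable f (g x) ->
  'D_v (f \o g) x = 'D_('D_v g x) f (g x).
Proof.
move=> dg df; rewrite deriveE; last exact: differentiable_comp.
by rewrite diff_comp//= -!deriveE.
Qed.

End pointwise.

Lemma derive_dir_sum (R : realType) n (W : normedModType R)
    (f : 'rV[R]_n -> W) x v : differentiable f x ->
  'D_v f x = \sum_s v ord0 s *: 'D_(delta_mx ord0 s) f x.
Proof.
move=> df; rewrite deriveE// [v in LHS]row_sum_delta linear_sum.
by apply: eq_bigr => s _; rewrite linearZ deriveE.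
Qed.

Section smooth.
Context {R : realType}.

Lemma smooth_diff n (W : normedModType R) (U : set 'rV[R]_n)
  (f : 'rV[R]_n -> W) x : smooth_on U f -> U x -> differentiable f x.
Proof. by move=> fs Ux; have [+ _] := fs 1%N; exact. Qed.

Lemma smooth_derivable n (W : normedModType R) (U : set 'rV[R]_n)
  (f : 'rV[R]_n -> W) x v : smooth_on U f -> U x -> derivable f x v.
Proof. by move=> fs Ux; apply: diff_derivable; exact: smooth_diff Ux. Qed.

Lemma smooth_derive n (W : normedModType R) (U : set 'rV[R]_n)
  (f : 'rV[R]_n -> W) v : smooth_on U f -> smooth_on U ('D_v f).
Proof. by move=> fs k; have [_] := fs k.+1; exact. Qed.

(** Glues descriptions of a map that are valid on different open sets. *)
Lemma smooth_local n (W : normedModType R) (U : set 'rV[R]_n)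
    (f : 'rV[R]_n -> W) :
  (forall x, U x -> exists2 O, O x & smooth_on O f) -> smooth_on U f.
Proof.
move=> fl k.
have : forall x, U x -> exists2 O, O x & C_on k O f.
  by move=> x /fl[V Vx fV]; exists V.
elim: k {fl} f => [|k IH] f fl; first by move=> x /fl[V Vx fV]; exact: fV.
split; first by move=> x /fl[V Vx [fV _]]; exact: fV.
by move=> v; apply: IH => x /fl[V Vx [_ fV]]; exists V => //; exact: fV.
Qed.

Section closure.
Context {n : nat} (U : set 'rV[R]_n) (Uo : open U).

Lemma smooth_ext (W : normedModType R) (f g : 'rV[R]_n -> W) :
  (forall x, U x -> f x = g x) -> smooth_on U f -> smooth_on U g.
Proof. by move=> fg fs k; exact: C_on_ext fg (fs k). Qed.

Lemma smooth_entry m p (f : 'rV[R]_n -> 'M[R]_(m, p)) a b :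
  smooth_on U f -> smooth_on U (fun x => f x a b).
Proof.
move=> fs k; have @L : {linear 'M[R]_(m, p) -> R}.
  by exists (fun N : 'M[R]_(m, p) => N a b); do 2![eexists]; do ?[constructor];
     rewrite ?mxE// => ? *; rewrite ?mxE//; move=> ?; rewrite !mxE.
apply: (C_on_linear Uo (L := L)) (fs k); exact: coord_continuous.
Qed.

Lemma smooth_mx m p (f : 'rV[R]_n -> 'M[R]_(m, p)) :
  (forall a b, smooth_on U (fun x => f x a b)) -> smooth_on U f.
Proof.
move=> fs k.
have -> : f = \sum_a \sum_b ( *:%R^~ (delta_mx a b) \o (fun x => f x a b)).
  apply/funext => x; rewrite {1}[f x]matrix_sum_delta fct_sumE.
  by apply: eq_bigr => a _; rewrite fct_sumE.
apply: C_on_sum => // a; apply: C_on_sum => // b.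
set e : 'M[R]_(m, p) := delta_mx a b.
have Llin : linear ( *:%R^~ e : R -> _).
  by move=> u y z; rewrite scalerDl scalerA.
pose L : {linear R -> 'M[R]_(m, p)} :=
  HB.pack ( *:%R^~ e) (GRing.isLinear.Build _ _ _ _ _ Llin).
rewrite -[ *:%R^~ e]/(L : _ -> _).
apply: (C_on_linear Uo); first exact: scalel_continuous.
exact: fs.
Qed.

Lemma smoothD (W : normedModType R) (f g : 'rV[R]_n -> W) :
  smooth_on U f -> smooth_on U g -> smooth_on U (fun x => f x + g x).
Proof. by move=> fs gs k; exact: C_onD. Qed.

Lemma smoothM (f g : 'rV[R]_n -> R) :
  smooth_on U f -> smooth_on U g -> smooth_on U (fun x => f x * g x).
Proof. by move=> fs gs k; exact: C_onM. Qed.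

Lemma smooth_cst (W : normedModType R) (w : W) : smooth_on U (fun=> w).
Proof. by move=> k; exact: C_on_cst. Qed.

Lemma smooth_sum (W : normedModType R) m (f : 'I_m -> 'rV[R]_n -> W) :
  (forall i, smooth_on U (f i)) -> smooth_on U (fun x => \sum_i f i x).
Proof.
move=> fs k; rewrite (_ : (fun _ => _) = \sum_i f i).
  by apply: C_on_sum => // i; exact: fs.
by apply/funext => x; rewrite fct_sumE.
Qed.

Lemma smooth_prod m (f : 'I_m -> 'rV[R]_n -> R) :
  (forall i, smooth_on U (f i)) -> smooth_on U (fun x => \prod_i f i x).
Proof.
move=> fs k; rewrite (_ : (fun _ => _) = \prod_i f i).
  by apply: big_ind => //;
    [exact: smooth_cst|move=> g h gk hk; exact: C_onM|move=> i _; exact: fs].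
by apply/funext => x; apply: esym; apply: (big_morph (fun f => f x)).
Qed.

Lemma smooth_mulmx m p q (f : 'rV[R]_n -> 'M[R]_(m, p))
    (g : 'rV[R]_n -> 'M[R]_(p, q)) :
  smooth_on U f -> smooth_on U g -> smooth_on U (fun x => f x *m g x).
Proof.
move=> fs gs; apply: smooth_mx => a b; under eq_fun do rewrite mxE.
by apply: smooth_sum => c; apply: smoothM; exact: smooth_entry.
Qed.

Lemma smooth_scalemx m p (f : 'rV[R]_n -> R) (g : 'rV[R]_n -> 'M[R]_(m, p)) :
  smooth_on U f -> smooth_on U g -> smooth_on U (fun x => f x *: g x).
Proof.
move=> fs gs; apply: smooth_mx => a b; under eq_fun do rewrite mxE.
by apply: smoothM => //; exact: smooth_entry.
Qed.

Lemma smooth_trmx m p (f : 'rV[R]_n -> 'M[R]_(m, p)) :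
  smooth_on U f -> smooth_on U (fun x => (f x)^T).
Proof.
move=> fs; apply: smooth_mx => a b; under eq_fun do rewrite mxE.
exact: smooth_entry.
Qed.

Lemma smooth_id : smooth_on U id.
Proof.
apply: smooth_mx => a b k.
by rewrite (ord1 a); exact: C_on_coord.
Qed.

End closure.

(** The chain rule in coordinates expresses each derivative of a composite by
    composites of derivatives, which makes the induction on the order work. *)
Lemma smooth_comp n m (U : set 'rV[R]_n) (O : set 'rV[R]_m)
    (g : 'rV[R]_n -> 'rV[R]_m) (f : 'rV[R]_m -> R) :
  open U -> smooth_on U g -> smooth_on O f -> (forall x, U x -> O (g x)) ->
  smooth_on U (f \o g).
Proof.
move=> Uo gs + gU k.
elim: k f => [|k IH] f fs.
  move=> x Ux; apply: continuous_comp; first exact: (gs 0%N).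
  exact: (fs 0%N _ (gU _ Ux)).
split=> [x Ux|v].
  apply: differentiable_comp; first exact: smooth_diff gs Ux.
  exact: smooth_diff fs (gU _ Ux).
apply: (@C_on_ext _ _ _ Uo _ k (\sum_s ((fun x => ('D_v g x) ord0 s) *
  ('D_(delta_mx ord0 s) f \o g)))).
  move=> x Ux; have df := smooth_diff fs (gU x Ux).
  rewrite fct_sumE derive_comp//; last exact: smooth_diff gs Ux.
  by rewrite derive_dir_sum.
apply: C_on_sum => // s; apply: C_onM => //.
  exact: (smooth_entry Uo _ _ (smooth_derive v gs)).
by apply: IH; exact: smooth_derive.
Qed.

Lemma smooth_comp_mx n m p q (U : set 'rV[R]_n) (O : set 'rV[R]_m)
    (g : 'rV[R]_n -> 'rV[R]_m) (f : 'rV[R]_m -> 'M[R]_(p, q)) :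
  open U -> open O -> smooth_on U g -> smooth_on O f ->
  (forall x, U x -> O (g x)) -> smooth_on U (f \o g).
Proof.
move=> Uo Oo gs fs gU; apply: smooth_mx => // a b.
apply: (smooth_comp (f := fun y => f y a b) Uo gs _ gU).
exact: (smooth_entry Oo a b fs).
Qed.

Lemma smooth_sub n (W : normedModType R) (U O : set 'rV[R]_n) (f : 'rV[R]_n -> W) :
  O `<=` U -> smooth_on U f -> smooth_on O f.
Proof. by move=> OU fs; apply: smooth_local => x /OU Ux; exists U. Qed.

Lemma smooth_block_mx n (U : set 'rV[R]_n) m1 m2 n1 n2
    (a : 'rV[R]_n -> 'M[R]_(m1, n1)) (b : 'rV[R]_n -> 'M[R]_(m1, n2))
    (c : 'rV[R]_n -> 'M[R]_(m2, n1)) (d : 'rV[R]_n -> 'M[R]_(m2, n2)) :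
  open U -> smooth_on U a -> smooth_on U b -> smooth_on U c -> smooth_on U d ->
  smooth_on U (fun y => block_mx (a y) (b y) (c y) (d y)).
Proof.
move=> Uo sa sb sc sd; apply: (smooth_mx Uo) => i j.
case: (split_ordP i) => k ->; case: (split_ordP j) => l ->.
- by under eq_fun do rewrite block_mxEul; exact: (smooth_entry Uo k l sa).
- by under eq_fun do rewrite block_mxEur; exact: (smooth_entry Uo k l sb).
- by under eq_fun do rewrite block_mxEdl; exact: (smooth_entry Uo k l sc).
- by under eq_fun do rewrite block_mxEdr; exact: (smooth_entry Uo k l sd).
Qed.

End smooth.

(** * Symmetry of second derivatives *)

Section schwarz.
Context {R : realType} {n : nat}.
Implicit Types (U : set 'rV[R]_n) (x u v : 'rV[R]_n) (f : 'rV[R]_n -> R).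

Lemma is_derive_line f x v t : differentiable f (x + t *: v) ->
  is_derive t 1 (fun s : R => f (x + s *: v)) ('D_v f (x + t *: v)).
Proof.
move=> df.
have dl : is_derive t (1 : R) (fun s : R => x + s *: v) v.
  have -> : (fun s : R => x + s *: v) = cst x + ( *:%R^~ v) by apply/funext.
  have dv : differentiable ( *:%R^~ v : R -> _) t.
    exact: (differentiableZl (k := id)).
  split; first by apply: derivableD => //; exact: diff_derivable.
  rewrite deriveD//; last exact: diff_derivable.
  rewrite derive_cst add0r deriveE// (diffZl (k := id))// diff_val.
  by rewrite /= scale1r.
have dl' : differentiable (fun s : R => x + s *: v) t.
  by apply/derivable1_diffP; case: dl.
have -> : (fun s => f (x + s *: v)) = f \o (fun s => x + s *: v) by [].
split; first by apply/derivable1_diffP; exact: differentiable_comp.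
by rewrite derive_comp// derive_val.
Qed.

Lemma MVT_line f x v h : 0 < h ->
  (forall s, 0 <= s <= h -> differentiable f (x + s *: v)) ->
  exists2 s, 0 <= s <= h & f (x + h *: v) - f x = h * 'D_v f (x + s *: v).
Proof.
move=> h0 df.
have [||s sh] := @MVT_segment R (fun s => f (x + s *: v))
    (fun s => 'D_v f (x + s *: v)) 0 h (ltW h0).
- move=> s; rewrite in_itv/= => /andP[s0 sh]; apply: is_derive_line.
  by apply: df; rewrite !ltW.
- apply: derivable_within_continuous => s; rewrite in_itv/= => sh.
  by case: (is_derive_line (df s sh)).
by rewrite scale0r addr0 subr0 mulrC => E; exists s.
Qed.

(** The mean value theorem, applied along [u] to a difference in the direction
    [v] and then along [v]. *)
Lemma second_difference U f x u v h : 0 < h ->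
  (forall s t, 0 <= s <= h -> 0 <= t <= h -> U (x + s *: u + t *: v)) ->
  smooth_on U f ->
  exists s t, [/\ 0 <= s <= h, 0 <= t <= h &
    f (x + h *: u + h *: v) - f (x + h *: u) - f (x + h *: v) + f x =
    h ^+ 2 * 'D_v ('D_u f) (x + s *: u + t *: v)].
Proof.
move=> h0 UU fs.
have hh : 0 <= h <= h by rewrite lexx ltW.
have h00 : 0 <= (0 : R) <= h by rewrite lexx ltW.
have dsh s : 0 <= s <= h -> differentiable f (x + s *: u + h *: v).
  by move=> sh; apply: (smooth_diff fs); exact: UU.
have ds0 s : 0 <= s <= h -> differentiable f (x + s *: u).
  by move=> sh; apply: (smooth_diff fs); rewrite -[_ + _]addr0 -(scale0r v); exact: UU.
pose g := fun y => f (y + h *: v) - f y.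
have dsh' s : 0 <= s <= h ->
    differentiable (fun y => f (y + h *: v)) (x + s *: u).
  move=> sh; apply: (@differentiable_comp _ _ _ _ (fun y => y + h *: v) f).
    by apply: differentiableD => //; exact: differentiable_cst.
  exact: dsh.
have [|s sh gE] := @MVT_line g x u h h0.
  by move=> s sh; apply: differentiableB; [exact: dsh'|exact: ds0].
have [|t th gE'] := @MVT_line ('D_u f) (x + s *: u) v h h0.
  move=> t th; apply: (smooth_diff (smooth_derive u fs)); exact: UU.
exists s, t; split=> //.
move: gE; rewrite /g deriveB; last 2 first.
- by apply: diff_derivable; exact: dsh'.
- by apply: diff_derivable; exact: ds0.
have -> : 'D_u (fun y => f (y + h *: v)) (x + s *: u) =
    'D_u f (x + s *: u + h *: v).
  rewrite (@derive_comp _ _ _ _ (fun y => y + h *: v) f); last 2 first.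
  - by apply: differentiableD => //; exact: differentiable_cst.
  - exact: dsh.
  by congr ('D_ _ _ _); rewrite deriveD ?derive_id ?derive_cst ?addr0.
rewrite gE' => E.
by rewrite expr2 -mulrA -E; ring.
Qed.

Lemma continuous_eq_near (F G : 'rV[R]_n -> R) x :
  {for x, continuous F} -> {for x, continuous G} ->
  (forall d, 0 < d -> exists y z, [/\ ball x d y, ball x d z & F y = G z]) ->
  F x = G x.
Proof.
move=> cF cG FG; apply/eqP; rewrite -subr_eq0 -normr_le0; apply/ler_addgt0Pl.
move=> e e0; rewrite addr0.
have e2 : 0 < e / 2 by rewrite divr_gt0.
move/cvgrPdist_le : cF => /(_ _ e2)/nbhs_ballP[d /= d0 dF].
move/cvgrPdist_le : cG => /(_ _ e2)/nbhs_ballP[d' /= d'0 d'G].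
have [|y [z [yd zd E]]] := FG (Num.min d d'); first by rewrite lt_min d0.
have md : Num.min d d' <= d by rewrite ge_min lexx.
have md' : Num.min d d' <= d' by rewrite ge_min lexx orbT.
have := dF y (le_ball md yd).
have := d'G z (le_ball md' zd).
rewrite /= -E => a b.
rewrite [e]splitr (_ : F x - G x = (F x - F y) - (G x - F y)); last by ring.
by apply: le_trans (ler_normB _ _) _; exact: lerD.
Qed.

(** Both iterated derivatives are, up to the factor [h ^+ 2], values near [x]
    of the same second difference, so continuity identifies them. *)
Lemma derive_comm U f x u v : open U -> smooth_on U f -> U x ->
  'D_u ('D_v f) x = 'D_v ('D_u f) x.
Proof.
move=> Uo fs Ux; apply: (@continuous_eq_near ('D_u ('D_v f)) ('D_v ('D_u f))).
- by have := smooth_derive u (smooth_derive v fs) 0%N x Ux.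
- by have := smooth_derive v (smooth_derive u fs) 0%N x Ux.
move=> d2 d20.
have /nbhs_ballP[d1 /= d10 dU] : nbhs x U by exact: open_nbhs_nbhs.
pose d := Num.min d2 d1.
have d0 : 0 < d by rewrite lt_min d20.
(* the summand 1 allows dividing by m even if u = v = 0 *)
pose m := `|u| + `|v| + 1.
have m0 : 0 < m by rewrite ltr_wpDl// addr_ge0.
pose h := d / 2 / m.
have h0 : 0 < h by rewrite !divr_gt0.
have hm : h * m < d.
  by rewrite /h divfK ?gt_eqF// ltr_pdivrMr// ltr_pMr// ltr1n.
have near_x s t : 0 <= s <= h -> 0 <= t <= h -> ball x d (x + s *: u + t *: v).
  move=> /andP[s0 sh] /andP[t0 th]; rewrite -ball_normE/= -addrA opprD addNKr normrN.
  apply: le_lt_trans hm; apply: le_trans (ler_normD _ _) _.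
  rewrite !normrZ !ger0_norm// /m !mulrDr mulr1 -[leLHS]addr0.
  by rewrite !lerD// ?(ltW h0)//; exact: ler_wpM2r.
have near_x' s t : 0 <= s <= h -> 0 <= t <= h -> ball x d (x + s *: v + t *: u).
  by move=> sh th; rewrite addrAC; exact: near_x.
have BU y : ball x d y -> U y.
  by move=> yd; apply: dU; apply: le_ball yd; rewrite ge_min lexx orbT.
have [|s [t [sh th E]]] := @second_difference U f x u v h h0 _ fs.
  by move=> s t sh th; apply: BU; exact: near_x.
have [|s' [t' [sh' th' E']]] := @second_difference U f x v u h h0 _ fs.
  by move=> a b ah bh; apply: BU; exact: near_x'.
exists (x + s' *: v + t' *: u), (x + s *: u + t *: v); split.
- by apply: (le_ball _ (near_x' _ _ sh' th')); rewrite ge_min lexx.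
- by apply: (le_ball _ (near_x _ _ sh th)); rewrite ge_min lexx.
have h2 : h ^+ 2 != 0 by rewrite expf_neq0// gt_eqF.
apply: (mulfI h2); apply: etrans (esym E') _; apply: etrans _ E.
by rewrite (addrAC x (h *: v)); congr (_ + _); exact: addrAC.
Qed.

Lemma derive_comm_mx m p U (f : 'rV[R]_n -> 'M[R]_(m, p)) x u v :
  open U -> smooth_on U f -> U x -> 'D_u ('D_v f) x = 'D_v ('D_u f) x.
Proof.
move=> Uo fs Ux; apply/matrixP => a b.
have E u' v' : ('D_u' ('D_v' f) x) a b = 'D_u' ('D_v' (fun y => f y a b)) x.
  rewrite derive_entry; last exact: smooth_derivable (smooth_derive v' fs) Ux.
  have nU : \near x, U x by exact: open_nbhs_nbhs.
  apply: near_eq_derive; near=> y.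
  have Uy : U y by near: y.
  by apply: derive_entry; exact: (smooth_derivable fs Uy).
apply: etrans (E u v) _; apply: etrans _ (esym (E v u)).
exact: (derive_comm _ _ Uo (smooth_entry Uo a b fs) Ux).
Unshelve. all: by end_near. Qed.

End schwarz.

Section moving_direction.
Context {R : realType}.
Context {m N p q : nat} (O : set 'rV[R]_m) (U : set 'rV[R]_N).
Variables (h l : 'rV[R]_m -> 'rV[R]_N) (f : 'rV[R]_N -> 'M[R]_(p, q)).
Hypotheses (Oo : open O) (Uo : open U) (hs : smooth_on O h) (ls : smooth_on O l).
Hypotheses (fs : smooth_on U f) (lU : forall z, O z -> U (l z)).

Lemma smooth_derive_dir : smooth_on O (fun z => 'D_(h z) f (l z)).
Proof.
apply: (@smooth_ext _ _ _ Oo _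
  (fun z => \sum_s h z ord0 s *: ('D_(delta_mx ord0 s) f \o l) z)).
  by move=> z /lU zU; rewrite [RHS]derive_dir_sum//; exact: smooth_diff fs zU.
apply: (smooth_sum Oo) => s; apply: (smooth_scalemx Oo).
  exact: (smooth_entry Oo ord0 s hs).
exact: (smooth_comp_mx Oo Uo ls (smooth_derive _ fs) lU).
Qed.

(** Product rule for a derivative whose direction and base point both move: the
    direction enters linearly, and moving the base point differentiates ['D f]
    once more, in an order that is immaterial. *)
Lemma derive_derive_dir z v : O z ->
  'D_v (fun z => 'D_(h z) f (l z)) z =
  'D_('D_v h z) f (l z) + 'D_('D_v l z) ('D_(h z) f) (l z).
Proof.
move=> Oz; have Uz := lU Oz.
have nO : \near z, O z by exact: open_nbhs_nbhs.
transitivity ('D_v (\sum_s (fun z => h z ord0 s *: ('D_(delta_mx ord0 s) f \o l) z)) z).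
  apply: near_eq_derive; near=> y; have Oy : O y by near: y.
  by rewrite fct_sumE derive_dir_sum//; exact: smooth_diff fs (lU Oy).
have dh := smooth_derivable (v := v) hs Oz.
have dl := smooth_diff ls Oz.
have df s := smooth_diff (smooth_derive (delta_mx ord0 s) fs) Uz.
have dc s : derivable ('D_(delta_mx ord0 s) f \o l) z v.
  by apply: diff_derivable; apply: differentiable_comp.
rewrite derive_sum; last first.
  by move=> s; apply: derivable_scalemx => //; exact: derivable_entry.
rewrite (derive_comm_mx _ _ Uo fs Uz) [in X in _ = X + _]derive_dir_sum; last first.
  exact: smooth_diff fs Uz.
rewrite [in X in _ = _ + X]derive_dir_sum; last first.
  exact: smooth_diff (smooth_derive _ fs) Uz.
rewrite -big_split; apply: eq_bigr => s _ /=.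
have dhs : derivable (fun y => h y ord0 s) z v by exact: derivable_entry.
have E : 'D_v (fun y => h y ord0 s) z = ('D_v h z) ord0 s.
  by apply: esym; exact: derive_entry.
apply: etrans (derive_scalemx dhs (dc s)) _.
by rewrite E (derive_comp v dl (df s)) (derive_comm_mx _ _ Uo fs Uz).
Unshelve. all: by end_near. Qed.

End moving_direction.

(** * Bump functions and differentials of global functions *)

Section flat.
Context {R : realType}.

(** A family closed under differentiation, containing the flat function
    [expR (- t^-1)]: smoothness follows for all members at once. *)
Definition flat (m : nat) (t : R) : R :=
  if 0 < t then t ^- m * expR (- t^-1) else 0.

Lemma flat_ge0 m t : 0 <= flat m t.
Proof.
rewrite /flat; case: ltP => // t0.
by rewrite mulr_ge0 ?expR_ge0// invr_ge0 exprn_ge0// ltW.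
Qed.

(** The term of order [m + 2] of the exponential series at [t^-1] bounds
    [flat m t]; thanks to the square, the difference quotients at [0] tend
    to [0]. *)
Lemma flat_le m t : flat m t <= (m.+2)`!%:R * t ^+ 2.
Proof.
rewrite /flat; case: ltP => t0; last by rewrite mulr_ge0// sqr_ge0.
have it0 : 0 <= t^-1 by rewrite invr_ge0 ltW.
have /(le_trans _) H := expR_ge1Dxn m.+1 it0.
have {H} : t^-1 ^+ m.+2 / (m.+2)`!%:R <= expR t^-1 by apply: H; rewrite lerDr.
have f0 : 0 < (m.+2)`!%:R :> R by rewrite ltr0n fact_gt0.
rewrite ler_pdivrMr// => H.
rewrite expRN ler_pdivrMr ?expR_gt0//.
have -> : t ^- m = t ^+ 2 * t^-1 ^+ m.+2.
  have tn0 : t != 0 by rewrite gt_eqF.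
  by rewrite exprVn !exprS; field; rewrite ?expf_neq0 ?tn0.
by rewrite [leRHS]mulrAC [leRHS]mulrC ler_pM2l ?exprn_gt0// mulrC.
Qed.

Lemma is_derive_flat_pos m (t : R) : 0 < t ->
  is_derive t 1 (fun s => s ^- m * expR (- s^-1))
    (flat m.+2 t - m%:R * flat m.+1 t).
Proof.
move=> t0; have tn0 : t != 0 by rewrite gt_eqF.
have tmn0 : t ^+ m != 0 by rewrite expf_neq0.
have dV : is_derive t 1 (fun s : R => - s^-1) (t ^- 2).
  apply: (is_derive_eq (is_deriveN (is_deriveV tn0 (is_derive_id t 1)))).
  by rewrite /= [_ *: 1]mulr1 opprK.
have dE := is_derive1_comp (f := expR) (g := fun s : R => - s^-1)
  (is_derive_expR (- t^-1)) dV.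
have dX : is_derive t 1 (fun s : R => s ^+ m) (m%:R * t ^+ m.-1).
  by split; [exact: exprn_derivable|rewrite exp_derive [_ *: 1]mulr1].
have dP := is_deriveV (f := fun s : R => s ^+ m) tmn0 dX.
apply: (is_derive_eq (is_deriveM dP dE)).
rewrite /flat t0 /= -![_ *: _]/(_ * _).
case: m tmn0 {dX dP} => [|m] tmn0; first by rewrite /= !expr0; field.
by rewrite /= !exprS; field; rewrite ?expf_neq0 ?tn0.
Qed.

Lemma is_derive_flat m (t : R) :
  is_derive t 1 (flat m) (flat m.+2 t - m%:R * flat m.+1 t).
Proof.
have [t0|t0|->] := ltgtP t 0.
- have -> : flat m.+2 t - m%:R * flat m.+1 t = 0.
    by rewrite /flat ltNge ltW//= mulr0 subr0.
  apply: (near_eq_is_derive (f := cst 0)) => //=.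
  near=> s; have s0 : s < 0 by near: s; exact: lt_nbhsl.
  by rewrite /flat ltNge ltW.
- apply: (near_eq_is_derive (g := flat m) _ (is_derive_flat_pos m t0)).
    near=> s; have s0 : 0 < s by near: s; exact: lt_nbhsr.
    by rewrite /flat s0.
- have -> : flat m.+2 0 - m%:R * flat m.+1 0 = 0.
    by rewrite /flat ltxx mulr0 subr0.
  suff H : h^-1 *: (flat m (h *: 1 + 0) - flat m 0) @[h --> 0^'] --> (0 : R).
    by split; [apply/cvg_ex; exists 0|exact: cvg_lim].
  have C0 : 0 < (m.+2)`!%:R :> R by rewrite ltr0n fact_gt0.
  apply/cvgrPdist_le => e e0; near=> h.
  have h0 : 0 < `|h| by rewrite normr_gt0; near: h; exact: nbhs_dnbhs_neq.
  have he : `|h| < e / (m.+2)`!%:R.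
    by near: h; apply: dnbhs0_lt; exact: divr_gt0.
  rewrite addr0 [h *: 1]mulr1 [flat m 0]/flat ltxx subr0 sub0r normrN.
  rewrite normrM normfV (ger0_norm (flat_ge0 _ _)) ler_pdivrMl//.
  apply: le_trans (flat_le m h) _.
  rewrite -real_normK ?num_real// expr2 mulrCA ler_pM2l// mulrC.
  by rewrite -ler_pdivlMr// ltW.
Unshelve. all: by end_near. Qed.

Lemma smooth_flat n m (U : set 'rV[R]_n) (g : 'rV[R]_n -> R) : open U ->
  smooth_on U g -> smooth_on U (flat m \o g).
Proof.
move=> Uo gs k; elim: k m => [|k IH] m.
  move=> x Ux; apply: continuous_comp; first exact: (gs 0%N).
  apply: differentiable_continuous; apply/derivable1_diffP.
  by case: (is_derive_flat m (g x)).
have dflat t : differentiable (flat m) t.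
  by apply/derivable1_diffP; case: (is_derive_flat m t).
split=> [x Ux|v].
  by apply: differentiable_comp => //; exact: smooth_diff gs Ux.
apply: (@C_on_ext _ _ _ Uo _ k
  (('D_v g) * ((flat m.+2 \o g) + (cst (- m%:R) * (flat m.+1 \o g))))).
  move=> x Ux; rewrite derive_comp//; last exact: smooth_diff gs Ux.
  rewrite -[X in 'D_X _ _]mulr1 -[_ * 1]/(_ *: 1) derive_dirZ//.
  have [_ ->] := is_derive_flat m (g x).
  by rewrite -[RHS]/(_ * _) -mulNr.
apply: C_onM => //; first exact: (smooth_derive v gs).
by apply: C_onD => //; apply: C_onM => //; exact: C_on_cst.
Qed.

(** A product over the coordinates of one-variable bumps: the norm of row
    vectors is the sup norm, and a function of it would not be smooth. *)
Lemma bump_exists n (U : set 'rV[R]_n) x0 : open U -> U x0 ->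
  exists K (chi : 'rV[R]_n -> R), [/\ compact K, K `<=` U, smooth_on setT chi,
    (forall x, ~ K x -> chi x = 0) & chi x0 != 0].
Proof.
move=> Uo Ux0.
have /nbhs_ballP[d /= d0 dU] : nbhs x0 U by exact: open_nbhs_nbhs.
pose r := d / 2.
have r0 : 0 < r by rewrite divr_gt0.
have rd : r < d by rewrite /r ltr_pdivrMr// ltr_pMr// ltr1n.
pose I a := `[x0 ord0 a - r, x0 ord0 a + r].
exists [set y | forall a, [set` I a] (y ord0 a)].
exists (fun y => \prod_a flat 0 (r ^+ 2 - (y ord0 a - x0 ord0 a) ^+ 2)).
split.
- apply: (@rV_compact R n (fun a => [set` I a])) => a.
  exact: segment_compact.
- move=> y yK; apply: dU; split=> // a b; rewrite ord1; have := yK b.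
  by rewrite /= in_itv/= -ler_distlC => yb; apply: le_lt_trans rd.
- apply: smooth_prod; first exact: openT.
  move=> a; apply: (@smooth_flat n 0 setT (fun y : 'rV[R]_n =>
    r ^+ 2 - (y ord0 a - x0 ord0 a) ^+ 2)); first exact: openT.
  have cs : smooth_on setT (fun y : 'rV[R]_n => y ord0 a - x0 ord0 a).
    apply: smoothD; [exact: openT| |exact: (smooth_cst openT)].
    exact: (smooth_entry openT ord0 a (smooth_id openT)).
  apply: (@smooth_ext _ _ _ openT _ (fun y : 'rV[R]_n => r ^+ 2 +
    (-1) * ((y ord0 a - x0 ord0 a) * (y ord0 a - x0 ord0 a)))).
    by move=> y _; rewrite expr2 mulN1r.
  apply: smoothD; [exact: openT|exact: (smooth_cst openT)|].
  apply: smoothM; [exact: openT|exact: (smooth_cst openT)|].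
  by apply: smoothM; [exact: openT| |].
- move=> y /existsNP[a ya]; rewrite (bigD1 a)//= {1}/flat ifF ?mul0r//.
  apply/negbTE; rewrite -leNgt subr_le0; move/negP: ya.
  rewrite in_itv/= -ler_distlC -ltNge distrC => /ltW ra.
  by rewrite -[leRHS]real_normK ?num_real// ler_sqr ?nnegrE// ltW.
- rewrite prodf_seq_neq0; apply/allP => a _; rewrite /= /flat.
  rewrite subrr expr0n/= subr0 exprn_gt0// mulf_neq0 ?expR_eq0//.
  by rewrite expr0 invr1 oner_neq0.
Qed.

End flat.

Section extension.
Context {R : realType} {N : nat} (M : manifold R N).
Implicit Types (i j : chart M).

(** The image of [K] is compact, hence closed as [M] is Hausdorff: off the
    domain of the chart the extension vanishes on a neighbourhood. *)
Lemma smooth_extension i (K : set 'rV[R]_N) (G : 'rV[R]_N -> R) :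
  compact K -> K `<=` cod i -> smooth_on (cod i) G ->
  (forall x, ~ K x -> G x = 0) ->
  smooth_function (fun q : M => if `[< dom i q >] then G (coord i q) else 0).
Proof.
move=> Kc Ki Gs G0 j; set F := fun q => _.
have Kcl : closed (param i @` K).
  apply: compact_closed; first exact: manifold_hausdorff.
  apply: continuous_compact => //; apply: continuous_in_subspaceT => x.
  by rewrite inE => /Ki; exact: param_cts.
apply: smooth_local => x xj.
have [xi|xi] := pselect (dom i (param j x)).
  exists (cod j `&` param j @^-1` dom i) => //.
  have Oo := @overlap_open _ _ M j i.
  apply: (@smooth_ext _ _ _ Oo _ (G \o (coord i \o param j))).
    by move=> y [yj yi] /=; rewrite /F asboolT.
  apply: (smooth_comp Oo (transition_smooth j i) Gs).
  by move=> y [yj yi]; exact: coord_cod.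
have Oo : open (cod j `&` param j @^-1` (~` (param i @` K))).
  rewrite openE => y [yj yK]; apply: filterI.
    by apply: open_nbhs_nbhs; split => //; exact: cod_open.
  by apply: (param_cts yj); apply: open_nbhs_nbhs; split => //; exact: closed_openC.
exists (cod j `&` param j @^-1` (~` (param i @` K))).
  split=> // -[y yK yx]; apply: xi; rewrite -yx; apply: param_dom; exact: Ki.
apply: (@smooth_ext _ _ _ Oo _ (cst 0)); last exact: smooth_cst.
move=> y [yj yK] /=; rewrite /F; case: asboolP => // yi.
rewrite G0// => H; apply: yK; exists (coord i (param j y)) => //.
exact: coordK.
Qed.

(** A linear form vanishing at the point, cut off by a bump function: by the
    product rule, the derivatives of the bump drop out at the point. *)
Lemma covector_realized i p (u : 'rV[R]_N) : dom i p ->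
  exists2 F : M -> R, smooth_function F &
    forall v, 'D_v (F \o param i) (coord i p) = (v *m u^T) ord0 ord0.
Proof.
move=> pi; set x0 := coord i p; have x0i : cod i x0 by exact: coord_cod.
have [K [chi [Kc Ki chis chi0 chix0]]] := bump_exists (@cod_open _ _ M i) x0i.
pose l (y : 'rV[R]_N) := (chi x0)^-1 * (((y - x0) *m u^T) ord0 ord0).
have ls : smooth_on setT l.
  apply: smoothM; [exact: openT|exact: (smooth_cst openT)|].
  apply: (smooth_entry openT ord0 ord0).
  apply: smooth_mulmx; [exact: openT| |exact: (smooth_cst openT)].
  by apply: smoothD; [exact: openT|exact: (smooth_id openT)|exact: (smooth_cst openT)].
have Gs := smoothM openT chis ls.
have Gsi : smooth_on (cod i) (fun y => chi y * l y).
  exact: smooth_sub (@subsetT _ _) Gs.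
exists (fun q : M => if `[< dom i q >] then chi (coord i q) * l (coord i q) else 0).
  apply: (@smooth_extension i K (fun y => chi y * l y)) => // x xK.
  by rewrite chi0// mul0r.
move=> v.
have -> : 'D_v ((fun q => if `[< dom i q >] then chi (coord i q) * l (coord i q)
    else 0) \o param i) x0 = 'D_v (chi * l) x0.
  apply: near_eq_derive; near=> y.
  have yi : cod i y by near: y; apply: open_nbhs_nbhs; split=> //; exact: cod_open.
  by rewrite /= asboolT ?paramK//; exact: param_dom.
rewrite deriveM; [|exact: smooth_derivable chis I|exact: smooth_derivable ls I].
have -> : l x0 = 0 by rewrite /l subrr mul0mx mxE mulr0.
rewrite scale0r addr0.
have dx : derivable (fun y : 'rV[R]_N => y - x0) x0 v by apply: derivableB.
have dy : derivable (fun y : 'rV[R]_N => (y - x0) *m u^T) x0 v.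
  exact: derivable_mulmx.
rewrite -[l]/((chi x0)^-1 \*: (fun y => ((y - x0) *m u^T) ord0 ord0)).
rewrite deriveZ; last exact: derivable_entry.
have dxE : 'D_v (fun y : 'rV[R]_N => y - x0) x0 = v.
  have := deriveB (@derivable_id _ _ x0 v) (@derivable_cst _ _ _ x0 x0 v).
  by rewrite derive_id derive_cst subr0.
rewrite -(derive_entry _ _ dy) (derive_mulmxc _ dx) dxE.
by rewrite scalerA mulfV// scale1r.
Unshelve. all: by end_near. Qed.

End extension.

(** * The Jacobi identity in coordinates *)

Section local_jacobi.
Context {R : realType} {n : nat}.
Implicit Types (U : set 'rV[R]_n) (A : 'rV[R]_n -> 'M[R]_n).
Implicit Types (x u v w : 'rV[R]_n) (f g h : 'rV[R]_n -> R).

Definition grad f x : 'rV[R]_n := \row_a 'D_(delta_mx ord0 a) f x.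

Definition hessian f x : 'M[R]_n :=
  \matrix_(a, b) 'D_(delta_mx ord0 a) ('D_(delta_mx ord0 b) f) x.

Definition local_bracket A f g x : R :=
  (grad f x *m A x *m (grad g x)^T) ord0 ord0.

(** [jacobiator_term A x u v w] is [u_a A^{ad} d_d A^{bc} v_b w_c]: the
    derivative of [A] along the Hamiltonian direction of the covector [u]. *)
Definition jacobiator_term A x u v w : R :=
  (v *m 'D_(u *m A x) A x *m w^T) ord0 ord0.

Definition jacobiator A x u v w : R :=
  jacobiator_term A x u v w + jacobiator_term A x v w u
    + jacobiator_term A x w u v.

Lemma derive_grad f x v : differentiable f x ->
  'D_v f x = (v *m (grad f x)^T) ord0 ord0.
Proof.
move=> df; rewrite derive_dir_sum// mxE; apply: eq_bigr => a _.
by rewrite !mxE.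
Qed.

Lemma local_bracketE A f g x : differentiable g x ->
  local_bracket A f g x = 'D_(grad f x *m A x) g x.
Proof. by move=> dg; rewrite derive_grad. Qed.

Lemma smooth_grad U f : open U -> smooth_on U f -> smooth_on U (grad f).
Proof.
move=> Uo fs; apply: (smooth_mx Uo) => a b.
by under eq_fun do rewrite mxE; exact: smooth_derive fs.
Qed.

Lemma smooth_local_bracket U A f g : open U ->
  smooth_on U A -> smooth_on U f -> smooth_on U g ->
  smooth_on U (local_bracket A f g).
Proof.
move=> Uo As fs gs; apply: (smooth_entry Uo).
apply: (smooth_mulmx Uo); last exact/(smooth_trmx Uo)/smooth_grad.
by apply: (smooth_mulmx Uo) => //; exact: smooth_grad.
Qed.

Lemma hessian_sym U f x : open U -> smooth_on U f -> U x ->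
  (hessian f x)^T = hessian f x.
Proof.
move=> Uo fs Ux; apply/matrixP => a b; rewrite !mxE.
exact: derive_comm Uo fs Ux.
Qed.

Lemma grad_derive U f x v : open U -> smooth_on U f -> U x ->
  'D_v (grad f) x = v *m hessian f x.
Proof.
move=> Uo fs Ux.
rewrite derive_mx; last exact: smooth_derivable (smooth_grad Uo fs) Ux.
apply/rowP => b; rewrite !mxE; under eq_fun do rewrite mxE.
have fb := smooth_derive (delta_mx ord0 b) fs.
rewrite derive_dir_sum; last exact: smooth_diff fb Ux.
by apply: eq_bigr => a _; rewrite mxE.
Qed.

(** [{f, -}] is the derivative along [grad f x *m A x].  The product rule and
    the skewness of [A] leave two terms with Hessians, of the same shape up to
    a cyclic shift of [f], [g], [h] and the sign. *)
Lemma local_bracket2 U A f g h x : open U ->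
  (forall y, U y -> (A y)^T = - A y) -> smooth_on U A ->
  smooth_on U f -> smooth_on U g -> smooth_on U h -> U x ->
  local_bracket A f (local_bracket A g h) x =
    jacobiator_term A x (grad f x) (grad g x) (grad h x)
    + (grad f x *m A x *m hessian g x *m A x *m (grad h x)^T) ord0 ord0
    - (grad g x *m A x *m hessian h x *m A x *m (grad f x)^T) ord0 ord0.
Proof.
move=> Uo Ask As fs gs hs Ux.
rewrite local_bracketE; last exact: smooth_diff (smooth_local_bracket Uo As gs hs) Ux.
set w := grad f x *m A x.
have dA : derivable A x w := smooth_derivable As Ux.
have dg : derivable (grad g) x w := smooth_derivable (smooth_grad Uo gs) Ux.
have dh : derivable (grad h) x w := smooth_derivable (smooth_grad Uo hs) Ux.
have dgA := derivable_mulmx dg dA.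
rewrite /local_bracket -derive_entry; last first.
  exact/(derivable_mulmx dgA)/derivable_trmx.
rewrite derive_mulmx//; last exact: derivable_trmx.
rewrite derive_mulmx// derive_trmx// !(grad_derive _ Uo)// trmx_mul.
rewrite (hessian_sym Uo)// /w trmx_mul Ask// mulNmx mulmxN !mulmxDl.
rewrite /jacobiator_term mulmxN !mulmxA !mxE.
by congr (_ + _); rewrite addrC.
Qed.

(** The terms with Hessians telescope in the cyclic sum, so that only first
    derivatives of the three functions remain. *)
Lemma local_bracket_jacobi U A f g h x : open U ->
  (forall y, U y -> (A y)^T = - A y) -> smooth_on U A ->
  smooth_on U f -> smooth_on U g -> smooth_on U h -> U x ->
  local_bracket A f (local_bracket A g h) x
  + local_bracket A g (local_bracket A h f) x
  + local_bracket A h (local_bracket A f g) x =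
  jacobiator A x (grad f x) (grad g x) (grad h x).
Proof.
move=> Uo Ask As fs gs hs Ux.
rewrite (local_bracket2 Uo Ask As fs gs hs Ux) (local_bracket2 Uo Ask As gs hs fs Ux).
rewrite (local_bracket2 Uo Ask As hs fs gs Ux) /jacobiator; ring.
Qed.

End local_jacobi.

Section manifold_jacobi.
Context {R : realType} {N : nat} (M : manifold R N).
Implicit Types (P : bivector_components M) (f g h : M -> R).

Lemma bracket_in_local P i f g x : cod i x ->
  bracket_in P i f g (param i x) =
  local_bracket (P i \o param i) (f \o param i) (g \o param i) x.
Proof.
move=> xi; rewrite /bracket_in /local_bracket mxE exchange_big/=.
apply: eq_bigr => b _; rewrite !mxE mulr_suml; apply: eq_bigr => a _.
by rewrite !mxE /partial paramK//; congr (_ * _); exact: mulrC.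
Qed.

Lemma bracket_local P i f g x : is_bivector_field P ->
  smooth_function f -> smooth_function g -> cod i x ->
  bracket P f g (param i x) =
  local_bracket (P i \o param i) (f \o param i) (g \o param i) x.
Proof.
move=> Pb fs gs xi; rewrite (bracketE Pb fs gs (param_dom xi)).
exact: bracket_in_local.
Qed.

Lemma smooth_bracket P f g : is_bivector_field P ->
  smooth_function f -> smooth_function g -> smooth_function (bracket P f g).
Proof.
move=> Pb fs gs i; have Uo := @cod_open _ _ M i.
apply: (@smooth_ext _ _ _ Uo _
    (local_bracket (P i \o param i) (f \o param i) (g \o param i))).
  by move=> x xi; rewrite /= bracket_local.
have [_ _ Ps] := Pb.
exact: (smooth_local_bracket Uo (Ps i) (fs i) (gs i)).
Qed.

Lemma eq_local_bracket n (A : 'rV[R]_n -> 'M[R]_n) (f g g' : 'rV[R]_n -> R) x :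
  (\near x, g x = g' x) -> local_bracket A f g x = local_bracket A f g' x.
Proof.
move=> gg'; rewrite /local_bracket; congr ((_ *m _^T) _ _).
by apply/rowP => a; rewrite !mxE; exact: near_eq_derive.
Qed.

Lemma bracket_jacobi P i f g h x : is_bivector_field P ->
  smooth_function f -> smooth_function g -> smooth_function h -> cod i x ->
  bracket P f (bracket P g h) (param i x) + bracket P g (bracket P h f) (param i x)
  + bracket P h (bracket P f g) (param i x) =
  jacobiator (P i \o param i) x (grad (f \o param i) x) (grad (g \o param i) x)
    (grad (h \o param i) x).
Proof.
move=> Pb fs gs hs xi; have Uo := @cod_open _ _ M i.
have [Psk _ Ps] := Pb.
have E f1 f2 f3 : smooth_function f1 -> smooth_function f2 -> smooth_function f3 ->
    bracket P f1 (bracket P f2 f3) (param i x) =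
    local_bracket (P i \o param i) (f1 \o param i)
      (local_bracket (P i \o param i) (f2 \o param i) (f3 \o param i)) x.
  move=> s1 s2 s3; rewrite bracket_local//; last exact: smooth_bracket.
  apply: eq_local_bracket; near=> y.
  have yi : cod i y by near: y; exact: open_nbhs_nbhs.
  by rewrite /= bracket_local.
rewrite !E//.
apply: (local_bracket_jacobi Uo _ (Ps i) (fs i) (gs i) (hs i) xi).
by move=> y yi; exact: (Psk i _ (param_dom yi)).
Unshelve. all: by end_near. Qed.

Lemma grad_realized i x u : cod i x ->
  exists2 f : M -> R, smooth_function f & grad (f \o param i) x = u.
Proof.
move=> xi; have [f fs fE] := covector_realized u (param_dom xi).
exists f => //; apply/rowP => a; rewrite mxE.
by move: (fE (delta_mx ord0 a)); rewrite paramK// => ->; rewrite -rowE !mxE.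
Qed.

(** In a chart the Jacobi identity is an identity of covectors, because every
    covector is the differential of a global function. *)
Lemma poisson_tensorP P :
  is_poisson_tensor P <->
  is_bivector_field P /\ forall i x, cod i x -> forall u v w,
    jacobiator (P i \o param i) x u v w = 0.
Proof.
split=> -[Pb PJ]; split=> //.
  move=> i x xi u v w.
  have [f fs <-] := grad_realized u xi.
  have [g gs <-] := grad_realized v xi.
  have [h hs <-] := grad_realized w xi.
  by rewrite -bracket_jacobi//; exact: PJ.
move=> f g h fs gs hs p; have [i pi] := dom_cover p.
by rewrite -(coordK pi) bracket_jacobi ?PJ//; exact: coord_cod.
Qed.

(** Testing the Casimir condition on functions with prescribed differentials
    gives it covector by covector. *)
Lemma casimir_local P (c : M -> R) i x u : is_bivector_field P ->
  is_casimir P c -> cod i x ->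
  'D_(u *m P i (param i x)) (c \o param i) x = 0.
Proof.
move=> Pb [cs cP] xi; have [f fs <-] := grad_realized u xi.
rewrite -(local_bracketE (P i \o param i)); last exact: smooth_diff (cs i) xi.
by rewrite -bracket_local//; exact: cP.
Qed.

End manifold_jacobi.

(** * Bivectors [X /\ Y] of Poisson vector fields *)

Section wedge.
Context {R : realType}.

Lemma smooth_wedge n m (U : set 'rV[R]_n) (f g : 'rV[R]_n -> 'rV[R]_m) :
  open U -> smooth_on U f -> smooth_on U g ->
  smooth_on U (fun x => wedge (f x) (g x)).
Proof.
move=> Uo fs gs.
apply: (@smooth_ext _ _ _ Uo _
  (fun x => (f x)^T *m g x + (-1) *: ((g x)^T *m f x))).
  by move=> x _; rewrite scaleN1r.
have sm f1 f2 : smooth_on U f1 -> smooth_on U f2 ->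
    smooth_on U (fun x => (f1 x : 'rV[R]_m)^T *m (f2 x : 'rV[R]_m)).
  by move=> s1 s2; apply: (smooth_mulmx Uo) => //; exact: smooth_trmx.
apply: (smoothD Uo); first exact: sm.
by apply: (smooth_scalemx Uo (smooth_cst Uo _)); exact: sm.
Qed.

Lemma derive_wedge (V : normedModType R) m (f g : V -> 'rV[R]_m) x v :
  derivable f x v -> derivable g x v ->
  'D_v (fun x => wedge (f x) (g x)) x =
  wedge ('D_v f x) (g x) + wedge (f x) ('D_v g x).
Proof.
move=> df dg.
have dft := derivable_trmx df; have dgt := derivable_trmx dg.
rewrite (deriveB (derivable_mulmx dft dg) (derivable_mulmx dgt df)).
rewrite (derive_mulmx dft dg) (derive_mulmx dgt df) !derive_trmx// /wedge.
by rewrite opprD [X in _ + X]addrC addrACA.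
Qed.

Lemma wedge_skew n (a b : 'rV[R]_n) : (wedge a b)^T = - wedge a b.
Proof. by rewrite /wedge linearB/= !trmx_mul !trmxK opprB. Qed.

Lemma wedge_mulmx n m (a b : 'rV[R]_n) (T : 'M[R]_(n, m)) :
  wedge (a *m T) (b *m T) = T^T *m wedge a b *m T.
Proof. by rewrite /wedge mulmxBr mulmxBl !trmx_mul !mulmxA. Qed.

Lemma wedge_row0 n (a b : 'rV[R]_n) :
  wedge (row_mx 0 a : 'rV[R]_(n + n)) (row_mx 0 b) = block_mx 0 0 0 (wedge a b).
Proof.
rewrite /wedge !tr_row_mx !mul_col_row !trmx0 !mul0mx !mulmx0.
by rewrite opp_block_mx add_block_mx !subr0.
Qed.

End wedge.

Section schouten.
Context {R : realType} {N : nat}.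
Implicit Types (u v w p q : 'rV[R]_N) (J : 'M[R]_N).

Lemma trmx11 (a : 'M[R]_1) : a^T = a.
Proof. by apply/matrixP => i j; rewrite mxE !ord1. Qed.

Lemma form_trmx u v (B : 'M[R]_N) :
  (u *m B *m v^T) ord0 ord0 = (v *m B^T *m u^T) ord0 ord0.
Proof. by rewrite -[u *m B *m v^T]trmx11 !trmx_mul trmxK mulmxA. Qed.

Lemma formD u v (B C : 'M[R]_N) :
  (u *m (B + C) *m v^T) ord0 ord0 =
  (u *m B *m v^T) ord0 ord0 + (u *m C *m v^T) ord0 ord0.
Proof. by rewrite mulmxDr mulmxDl mxE. Qed.

Lemma formZ u v a (B : 'M[R]_N) :
  (u *m (a *: B) *m v^T) ord0 ord0 = a * (u *m B *m v^T) ord0 ord0.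
Proof. by rewrite -scalemxAr -scalemxAl mxE. Qed.

Lemma pairing_sym u v : (u *m v^T) ord0 ord0 = (v *m u^T) ord0 ord0.
Proof. by rewrite -[u *m v^T]trmx11 trmx_mul trmxK. Qed.

Lemma wedge_form p q v w : (v *m wedge p q *m w^T) ord0 ord0 =
  (v *m p^T) ord0 ord0 * (w *m q^T) ord0 ord0
  - (v *m q^T) ord0 ord0 * (w *m p^T) ord0 ord0.
Proof.
have E (a b : 'rV[R]_N) : (v *m (a^T *m b) *m w^T) ord0 ord0 =
    (v *m a^T) ord0 ord0 * (w *m b^T) ord0 ord0.
  rewrite !mulmxA -[_ *m b *m _]mulmxA [X in X *m _](mx11_scalar (v *m a^T)).
  by rewrite mul_scalar_mx mxE (pairing_sym w).
by rewrite -!E /wedge mulmxBr mulmxBl !mxE.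
Qed.

Lemma mul_wedge u p q : u *m wedge p q =
  (u *m p^T) ord0 ord0 *: q - (u *m q^T) ord0 ord0 *: p.
Proof.
rewrite /wedge mulmxBr !mulmxA.
rewrite [X in X *m q - _](mx11_scalar (u *m p^T)) mul_scalar_mx.
by rewrite [X in X *m p](mx11_scalar (u *m q^T)) mul_scalar_mx.
Qed.

(** The Schouten bracket of [A] with [X /\ Y] is, by the Leibniz rule, built
    from the Lie derivatives of [A] along [X] and [Y].  Here [D] is the
    differential of [A] at a point, [JX] and [JY] are the Jacobians there, and
    the sum of two wedges is the derivative of [X /\ Y] along [u *m A]. *)
Lemma schouten_wedge (A JX JY : 'M[R]_N) (X Y : 'rV[R]_N)
    (D : {linear 'rV[R]_N -> 'M[R]_N}) u v w :
  A^T = - A -> D X = JX^T *m A + A *m JX -> D Y = JY^T *m A + A *m JY ->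
  let term u v w := (v *m (D (u *m wedge X Y)
      + (wedge (u *m A *m JX) Y + wedge X (u *m A *m JY))) *m w^T) ord0 ord0 in
  term u v w + term v w u + term w u v = 0.
Proof.
move=> Ask DX DY term.
have E J (a b : 'rV[R]_N) : (a *m (J^T *m A + A *m J) *m b^T) ord0 ord0 =
    (a *m A *m J *m b^T) ord0 ord0 - (b *m A *m J *m a^T) ord0 ord0.
  have EJ : (a *m (J^T *m A) *m b^T) ord0 ord0 =
      - (b *m A *m J *m a^T) ord0 ord0.
    by rewrite form_trmx trmx_mul trmxK Ask mulNmx mulmxN mulNmx mxE mulmxA.
  by rewrite mulmxDr mulmxDl mxE EJ addrC mulmxA.
have termE (a b c : 'rV[R]_N) : term a b c =
    (a *m X^T) ord0 ord0 * ((b *m A *m JY *m c^T) ord0 ord0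
                            - (c *m A *m JY *m b^T) ord0 ord0)
    - (a *m Y^T) ord0 ord0 * ((b *m A *m JX *m c^T) ord0 ord0
                              - (c *m A *m JX *m b^T) ord0 ord0)
    + (((a *m A *m JX *m b^T) ord0 ord0 * (c *m Y^T) ord0 ord0
        - (b *m Y^T) ord0 ord0 * (a *m A *m JX *m c^T) ord0 ord0)
       + ((b *m X^T) ord0 ord0 * (a *m A *m JY *m c^T) ord0 ord0
          - (a *m A *m JY *m b^T) ord0 ord0 * (c *m X^T) ord0 ord0)).
  rewrite /term formD (formD _ _ (wedge _ _)) !wedge_form mul_wedge.
  have -> (s t : R) : D (s *: Y - t *: X) = s *: D Y + (- t) *: D X.
    by rewrite -scaleNr linearD !linearZZ.
  rewrite formD !formZ DX DY !E mulNr.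
  rewrite (pairing_sym b (a *m A *m JX)) (pairing_sym c (a *m A *m JX)).
  by rewrite (pairing_sym b (a *m A *m JY)) (pairing_sym c (a *m A *m JY)).
rewrite !termE; ring.
Qed.

End schouten.

(** * The deformed tensor in coordinates *)

Section tangent_calculus.
Context {R : realType}.

Section lrsubmx.
Context {N : nat}.
Let lsub : 'rV[R]_(N + N) -> 'rV[R]_N := lsubmx.
Let rsub : 'rV[R]_(N + N) -> 'rV[R]_N := rsubmx.

Lemma smooth_lsubmx : smooth_on setT lsub.
Proof.
apply: (smooth_mx openT) => a b; under eq_fun do rewrite mxE.
exact: (smooth_entry openT a (lshift N b) (smooth_id openT)).
Qed.

Lemma smooth_rsubmx : smooth_on setT rsub.
Proof.
apply: (smooth_mx openT) => a b; under eq_fun do rewrite mxE.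
exact: (smooth_entry openT a (rshift N b) (smooth_id openT)).
Qed.

Lemma derive_lsubmx z v : 'D_v lsub z = lsubmx v.
Proof.
rewrite deriveE; last exact: smooth_diff smooth_lsubmx I.
by rewrite /lsub diff_lin//; exact: rV_linear_continuous.
Qed.

Lemma derive_rsubmx z v : 'D_v rsub z = rsubmx v.
Proof.
rewrite deriveE; last exact: smooth_diff smooth_rsubmx I.
by rewrite /rsub diff_lin//; exact: rV_linear_continuous.
Qed.

End lrsubmx.

Section tangent_map.
Context {N p q : nat} (U : set 'rV[R]_N) (Uo : open U).
Variables (f : 'rV[R]_N -> 'M[R]_(p, q)) (fs : smooth_on U f).

Let Op : open [set z : 'rV[R]_(N + N) | U (lsubmx z)] := lsub_open Uo.

Lemma smooth_lsub_comp :
  smooth_on [set z : 'rV[R]_(N + N) | U (lsubmx z)] (fun z => f (lsubmx z)).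
Proof.
apply: (smooth_comp_mx Op Uo _ fs) => //.
exact: smooth_sub (@subsetT _ _) smooth_lsubmx.
Qed.

Lemma derive_lsub_comp (z v : 'rV[R]_(N + N)) : U (lsubmx z) ->
  'D_v (fun z => f (lsubmx z)) z = 'D_(lsubmx v) f (lsubmx z).
Proof.
move=> Uz; have dl := smooth_diff (@smooth_lsubmx N) (I : setT z).
by have := derive_comp v dl (smooth_diff fs Uz); rewrite derive_lsubmx.
Qed.

Lemma smooth_fibre_derive :
  smooth_on [set z : 'rV[R]_(N + N) | U (lsubmx z)]
    (fun z => 'D_(rsubmx z) f (lsubmx z)).
Proof.
exact: (smooth_derive_dir Op Uo
  (smooth_sub (@subsetT _ _) (@smooth_rsubmx N))
  (smooth_sub (@subsetT _ _) (@smooth_lsubmx N)) fs (fun _ => id)).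
Qed.

Lemma derive_fibre_derive (z v : 'rV[R]_(N + N)) : U (lsubmx z) ->
  'D_v (fun z => 'D_(rsubmx z) f (lsubmx z)) z =
  'D_(rsubmx v) f (lsubmx z) + 'D_(lsubmx v) ('D_(rsubmx z) f) (lsubmx z).
Proof.
move=> Uz.
have E := derive_derive_dir Op Uo
  (smooth_sub (@subsetT _ _) (@smooth_rsubmx N))
  (smooth_sub (@subsetT _ _) (@smooth_lsubmx N)) fs (fun _ => id) v Uz.
by apply: etrans E _; rewrite derive_lsubmx derive_rsubmx.
Qed.

End tangent_map.

End tangent_calculus.

(** The components of the deformed tensor in a chart of the tangent bundle,
    where [k] stands for the coefficient of the bivector [X /\ Y]. *)
Definition lifted (R : realType) N (A : 'rV[R]_N -> 'M[R]_N) (k : 'rV[R]_N -> R)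
    (X Y : 'rV[R]_N -> 'rV[R]_N) (z : 'rV[R]_(N + N)) : 'M[R]_(N + N) :=
  block_mx 0 (A (lsubmx z)) (A (lsubmx z))
    ('D_(rsubmx z) A (lsubmx z)
     + k (lsubmx z) *: wedge (X (lsubmx z)) (Y (lsubmx z))).

Section lifted.
Context {R : realType} {N : nat} (U : set 'rV[R]_N) (Uo : open U).
Variables (A : 'rV[R]_N -> 'M[R]_N) (k : 'rV[R]_N -> R).
Variables (X Y : 'rV[R]_N -> 'rV[R]_N).
Hypotheses (As : smooth_on U A) (ks : smooth_on U k).
Hypotheses (Xs : smooth_on U X) (Ys : smooth_on U Y).
Hypothesis Ask : forall x, U x -> (A x)^T = - A x.

Let tU : set 'rV[R]_(N + N) := [set z | U (lsubmx z)].
Let tUo : open tU := lsub_open Uo.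

Let B x := k x *: wedge (X x) (Y x).

Let Bs : smooth_on U B.
Proof. exact: (smooth_scalemx Uo ks (smooth_wedge Uo Xs Ys)). Qed.

Lemma smooth_lifted : smooth_on tU (lifted A k X Y).
Proof.
have As' := smooth_lsub_comp Uo As.
apply: (smooth_block_mx tUo (smooth_cst tUo _) As' As').
exact: (smoothD tUo (smooth_fibre_derive Uo As) (smooth_lsub_comp Uo Bs)).
Qed.

Lemma derive_skew x v : U x -> ('D_v A x)^T = - 'D_v A x.
Proof.
move=> Ux; have dA : derivable A x v := smooth_derivable As Ux.
rewrite -derive_trmx// -deriveN//; apply: near_eq_derive; near=> y.
by apply: Ask; near: y; exact: open_nbhs_nbhs.
Unshelve. all: by end_near. Qed.

Lemma lifted_skew z : tU z -> (lifted A k X Y z)^T = - lifted A k X Y z.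
Proof.
move=> Uz; rewrite /lifted tr_block_mx opp_block_mx trmx0 oppr0 Ask//.
by rewrite linearD/= linearZ/= wedge_skew derive_skew// scalerN opprD.
Qed.

Lemma derive_lifted z v : tU z ->
  'D_v (lifted A k X Y) z =
  block_mx 0 ('D_(lsubmx v) A (lsubmx z)) ('D_(lsubmx v) A (lsubmx z))
    ('D_(rsubmx v) A (lsubmx z) + 'D_(lsubmx v) ('D_(rsubmx z) A) (lsubmx z)
     + 'D_(lsubmx v) B (lsubmx z)).
Proof.
move=> Uz.
have sA := smooth_lsub_comp Uo As; have sB := smooth_lsub_comp Uo Bs.
have sD := smooth_fibre_derive Uo As.
have dA := smooth_derivable (v := v) sA Uz.
have dB := smooth_derivable (v := v) sB Uz.
have dD := smooth_derivable (v := v) sD Uz.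
have EA := derive_lsub_comp As v Uz; have EB := derive_lsub_comp Bs v Uz.
have ED := derive_fibre_derive Uo As v Uz.
have d0 := derivable_cst (0 : 'M[R]_N) z v.
apply: etrans (derive_block_mx d0 dA dA (derivableD dD dB)) _.
by rewrite (deriveD dD dB) EA EB ED (derive_cst (0 : 'M[R]_N) z v).
Qed.

(** By symmetry of second derivatives, [A] is differentiated along [y] in each
    of its two occurrences: these are the two kinds of terms that the summand
    ['D_y A x] of the lower right block contributes to the jacobiator. *)
Lemma derive_jacobiator_term x u v w y : U x ->
  'D_y (fun x => jacobiator_term A x u v w) x =
  (v *m ('D_(u *m 'D_y A x) A x + 'D_(u *m A x) ('D_y A) x) *m w^T) ord0 ord0.
Proof.
move=> Ux.
have uAs : smooth_on U (fun x => u *m A x).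
  exact: (smooth_mulmx Uo (smooth_cst Uo _) As).
have dA : derivable A x y := smooth_derivable As Ux.
have DAs := smooth_derive_dir Uo Uo uAs (smooth_id Uo) As (fun _ => id).
have dDA : derivable (fun x => 'D_(u *m A x) A x) x y := smooth_derivable DAs Ux.
have dvDA := derivable_mulmx (derivable_cst v x y) dDA.
have dvDAw := derivable_mulmx dvDA (derivable_cst w^T x y).
rewrite -(derive_entry _ _ dvDAw) derive_mulmxc// derive_cmulmx//.
have E := derive_derive_dir Uo Uo uAs (smooth_id Uo) As (fun _ => id) y Ux.
rewrite (derive_cmulmx u dA) (derive_id x y) in E.
by rewrite E (derive_comm_mx y (u *m A x) Uo As Ux).
Qed.

End lifted.

Section lifted_jacobi.
Context {R : realType} {N : nat} (U : set 'rV[R]_N) (Uo : open U).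
Variables (A : 'rV[R]_N -> 'M[R]_N) (k : 'rV[R]_N -> R).
Variables (X Y : 'rV[R]_N -> 'rV[R]_N).
Hypotheses (As : smooth_on U A) (ks : smooth_on U k).
Hypotheses (Xs : smooth_on U X) (Ys : smooth_on U Y).
Hypothesis Ask : forall x, U x -> (A x)^T = - A x.
Hypothesis AJ : forall x, U x -> forall u v w, jacobiator A x u v w = 0.
Hypothesis kA : forall x, U x -> forall u, 'D_(u *m A x) k x = 0.
Hypothesis XA : forall x, U x ->
  'D_(X x) A x = ('J X x)^T *m A x + A x *m 'J X x.
Hypothesis YA : forall x, U x ->
  'D_(Y x) A x = ('J Y x)^T *m A x + A x *m 'J Y x.

Let B x := wedge (X x) (Y x).

Lemma smooth_jacobiator_term u v w :
  smooth_on U (fun x => jacobiator_term A x u v w).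
Proof.
have uAs : smooth_on U (fun x => u *m A x).
  exact: (smooth_mulmx Uo (smooth_cst Uo _) As).
have DAs := smooth_derive_dir Uo Uo uAs (smooth_id Uo) As (fun _ => id).
apply: (smooth_entry Uo).
apply: (smooth_mulmx Uo _ (smooth_cst Uo _)).
exact: (smooth_mulmx Uo (smooth_cst Uo _) DAs).
Qed.

(** Sorts the terms of [jacobiator_term_lifted] by their origin. *)
Lemma lifted_form (v1 v2 w1 w2 : 'rV[R]_N) (D1 D2 D3 D4 D5 W : 'M[R]_N) a :
  (v2 *m D1 *m w1^T +
   (v1 *m D1 + v2 *m (D2 + D3 + a *: D4 + D5 + a *: W)) *m w2^T) ord0 ord0 =
  (v1 *m D1 *m w2^T) ord0 ord0 + (v2 *m D1 *m w1^T) ord0 ord0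
  + (v2 *m D2 *m w2^T) ord0 ord0 + (v2 *m (D3 + D5) *m w2^T) ord0 ord0
  + a * (v2 *m (D4 + W) *m w2^T) ord0 ord0.
Proof.
by rewrite mulmxDl mxE [X in _ + X]mxE !formD !formZ; ring.
Qed.

(** The indices number the cyclic positions.  The three jacobiators of the base
    mix the positions of [a], [b], [c], which carry the base component in their
    second, third and first covector respectively. *)
Lemma cyclic_cancel (a1 a2 a3 b1 b2 b3 c1 c2 c3 d1 d2 d3 s1 s2 s3 e : R) :
  a1 + c2 + b3 = 0 -> c1 + b2 + a3 = 0 -> b1 + a2 + c3 = 0 ->
  d1 + d2 + d3 = 0 -> s1 + s2 + s3 = 0 ->
  (a1 + b1 + c1 + d1 + e * s1) + (a2 + b2 + c2 + d2 + e * s2)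
  + (a3 + b3 + c3 + d3 + e * s3) = 0.
Proof.
move=> H1 H2 H3 H4 H5.
transitivity ((a1 + c2 + b3) + (c1 + b2 + a3) + (b1 + a2 + c3)
  + (d1 + d2 + d3) + e * (s1 + s2 + s3)); first by ring.
by rewrite H1 H2 H3 H4 H5 mulr0 !addr0.
Qed.

(** The direction [u *m lifted A k X Y z] has base component [u2 *m A x], along
    which the derivative of [k] vanishes, and a fibre component with summands
    coming from [u1], ['D_y A] and [X /\ Y]; the latter two pair up with the
    derivatives of the two summands of the lower right block. *)
Lemma jacobiator_term_lifted z u v w : U (lsubmx z) ->
  let x := lsubmx z in
  let u1 := lsubmx u in let u2 := rsubmx u in
  let v1 := lsubmx v in let v2 := rsubmx v in
  let w1 := lsubmx w in let w2 := rsubmx w in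
  jacobiator_term (lifted A k X Y) z u v w =
  jacobiator_term A x u2 v1 w2 + jacobiator_term A x u2 v2 w1
  + jacobiator_term A x u1 v2 w2
  + 'D_(rsubmx z) (fun x => jacobiator_term A x u2 v2 w2) x
  + k x * (v2 *m ('D_(u2 *m B x) A x
      + (wedge (u2 *m A x *m 'J X x) (Y x) + wedge (X x) (u2 *m A x *m 'J Y x)))
      *m w2^T) ord0 ord0.
Proof.
move=> Uz x u1 u2 v1 v2 w1 w2.
have Ux : U x by [].
have dA : differentiable A x := smooth_diff As Ux.
have uE : u *m lifted A k X Y z =
    row_mx (u2 *m A x) (u1 *m A x + u2 *m 'D_(rsubmx z) A x + k x *: (u2 *m B x)).
  rewrite -[u]hsubmxK mul_row_block mulmx0 add0r mulmxDr addrA.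
  by rewrite -scalemxAr.
have DBE : 'D_(u2 *m A x) (fun x => k x *: B x) x = k x *:
    (wedge (u2 *m A x *m 'J X x) (Y x) + wedge (X x) (u2 *m A x *m 'J Y x)).
  have dk := smooth_derivable (v := u2 *m A x) ks Ux.
  have dX := smooth_derivable (v := u2 *m A x) Xs Ux.
  have dY := smooth_derivable (v := u2 *m A x) Ys Ux.
  have dB := smooth_derivable (v := u2 *m A x) (smooth_wedge Uo Xs Ys) Ux.
  apply: etrans (derive_scalemx dk dB) _.
  rewrite kA// scale0r add0r (derive_wedge dX dY).
  by rewrite (deriveEjacobian _ (smooth_diff Xs Ux)) (deriveEjacobian _ (smooth_diff Ys Ux)).
rewrite /jacobiator_term (derive_lifted Uo As ks Xs Ys)// uE row_mxKl row_mxKr.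
rewrite -/x DBE (derive_jacobiator_term Uo As)//.
rewrite !(derive_dirD _ _ dA) (derive_dirZ _ _ dA).
rewrite -[v]hsubmxK -[w]hsubmxK mul_row_block tr_row_mx mul_row_col.
rewrite -/v1 -/v2 -/w1 -/w2 mulmx0 add0r.
exact: lifted_form.
Qed.

Lemma lifted_jacobi z : U (lsubmx z) ->
  forall u v w, jacobiator (lifted A k X Y) z u v w = 0.
Proof.
move=> Uz u v w; rewrite /jacobiator !jacobiator_term_lifted//.
set x := lsubmx z.
have dA : differentiable A x := smooth_diff As Uz.
have AJ' := AJ Uz.
have DJ a b c : 'D_(rsubmx z) (fun x => jacobiator_term A x a b c) x
    + 'D_(rsubmx z) (fun x => jacobiator_term A x b c a) x
    + 'D_(rsubmx z) (fun x => jacobiator_term A x c a b) x = 0.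
  have dJ a' b' c' : derivable (fun x => jacobiator_term A x a' b' c') x (rsubmx z).
    exact: smooth_derivable (smooth_jacobiator_term a' b' c') Uz.
  rewrite -(deriveD (dJ a b c) (dJ b c a)) -deriveD//; last exact: derivableD.
  rewrite -[RHS](derive_cst (0 : R) x (rsubmx z)).
  apply: near_eq_derive; near=> y.
  have Uy : U y by near: y; exact: open_nbhs_nbhs.
  exact: AJ Uy a b c.
have S a b c : let term a b c := (a *m ('D_(c *m B x) A x
      + (wedge (c *m A x *m 'J X x) (Y x) + wedge (X x) (c *m A x *m 'J Y x)))
      *m b^T) ord0 ord0 in term b c a + term c a b + term a b c = 0.
  rewrite /= !(deriveE _ dA); apply: schouten_wedge; first exact: Ask.
  - by rewrite -(deriveE _ dA) XA.
  - by rewrite -(deriveE _ dA) YA.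
have {}S := S (rsubmx u) (rsubmx v) (rsubmx w).
have {}DJ := DJ (rsubmx u) (rsubmx v) (rsubmx w).
have J1 := AJ' (rsubmx u) (lsubmx v) (rsubmx w).
have J2 := AJ' (lsubmx u) (rsubmx v) (rsubmx w).
have J3 := AJ' (rsubmx u) (rsubmx v) (lsubmx w).
move: S DJ J1 J2 J3; rewrite /jacobiator /= => S DJ J1 J2 J3.
exact: cyclic_cancel J1 J2 J3 DJ S.
Unshelve. all: by end_near. Qed.

End lifted_jacobi.

(** * The tangent bundle *)

Section blocks.
Context {R : realType}.

Lemma sum_block_mx n m1 m2 n1 n2 (a : 'I_n -> 'M[R]_(m1, n1))
    (b : 'I_n -> 'M[R]_(m1, n2)) (c : 'I_n -> 'M[R]_(m2, n1))
    (d : 'I_n -> 'M[R]_(m2, n2)) :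
  \sum_i block_mx (a i) (b i) (c i) (d i) =
  block_mx (\sum_i a i) (\sum_i b i) (\sum_i c i) (\sum_i d i).
Proof.
elim: n a b c d => [|n IH] a b c d; first by rewrite !big_ord0 block_mx0.
by rewrite !big_ord_recl IH add_block_mx.
Qed.

Lemma matrix_sum_delta_tr m n (A : 'M[R]_(m, n)) :
  A^T = \sum_a \sum_b A a b *: delta_mx b a.
Proof.
rewrite [A in LHS]matrix_sum_delta linear_sum; apply: eq_bigr => a _.
by rewrite linear_sum; apply: eq_bigr => b _; rewrite linearZ/= trmx_delta.
Qed.

End blocks.

Section tangent.
Context {R : realType} {N : nat} (M : manifold R N).
Implicit Types (i j : chart M) (u : tangent_vector M).

Lemma basis_xE a : basis_x a = row_mx (delta_mx ord0 a : 'rV[R]_N) 0.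
Proof.
apply/rowP => b; case: (split_ordP b) => l ->.
  by rewrite row_mxEl !mxE eq_lshift.
by rewrite row_mxEr !mxE eq_rlshift.
Qed.

Lemma basis_yE a : basis_y a = row_mx 0 (delta_mx ord0 a : 'rV[R]_N).
Proof.
apply/rowP => b; case: (split_ordP b) => l ->.
  by rewrite row_mxEl !mxE eq_lrshift.
by rewrite row_mxEr !mxE eq_rshift.
Qed.

Lemma vertical_liftE (X : vector_components M) i u :
  vertical_lift X i u = row_mx 0 (X i (foot u)).
Proof.
rewrite /vertical_lift [in RHS](row_sum_delta (X i (foot u))).
have E (a : 'rV[R]_N) : row_mx 0 a = a *m row_mx 0 1%:M :> 'rV[R]_(N + N).
  by rewrite mul_mx_row mulmx0 mulmx1.
rewrite E mulmx_suml; apply: eq_bigr => a _.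
by rewrite basis_yE E scalemxAl.
Qed.

Lemma wedge_xy a b :
  wedge (basis_x a) (basis_y b : 'rV[R]_(N + N)) =
  block_mx 0 (delta_mx a b) (- delta_mx b a) 0.
Proof.
rewrite basis_xE basis_yE /wedge !tr_row_mx !mul_col_row !trmx0 !mul0mx !mulmx0.
rewrite !trmx_delta !mul_delta_mx.
by rewrite opp_block_mx add_block_mx !oppr0 !addr0 add0r.
Qed.

Lemma wedge_yy a b :
  wedge (basis_y a) (basis_y b : 'rV[R]_(N + N)) =
  block_mx 0 0 0 (delta_mx a b - delta_mx b a).
Proof.
by rewrite !basis_yE wedge_row0 /wedge !trmx_delta !mul_delta_mx.
Qed.

(** The sum over [s] is a derivative along the velocity; it is skew, so the
    factor one half compensates that each pair of indices occurs twice. *)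
Lemma tangent_liftE (P : bivector_components M) i u :
  is_bivector_field P -> dom i (foot u) ->
  tangent_lift P i u = block_mx 0 (P i (foot u)) (P i (foot u))
    ('D_(velocity u i) (P i \o param i) (coord i (foot u))).
Proof.
move=> [Psk _ Ps] ui; set A := P i \o param i; set x := coord i (foot u).
have xi : cod i x by exact: coord_cod.
have dA : differentiable A x := smooth_diff (Ps i) xi.
set W := 'D_(velocity u i) A x.
have Wsk : W^T = - W.
  apply: (derive_skew (@cod_open _ _ M i) (Ps i) _ _ xi) => y yi.
  exact: (Psk i _ (param_dom yi)).
rewrite /tangent_lift.
have Z : \sum_(a < N) \sum_(b < N) 0 = 0 :> 'M[R]_N.
  by rewrite big1// => a _; rewrite big1.
have -> : \sum_a \sum_b P i (foot u) a b *: wedge (basis_x a) (basis_y b) =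
    block_mx 0 (P i (foot u)) (P i (foot u)) 0.
  transitivity (\sum_a \sum_b block_mx 0 (P i (foot u) a b *: delta_mx a b)
      (- (P i (foot u) a b *: delta_mx b a)) (0 : 'M[R]_N)).
    apply: eq_bigr => a _; apply: eq_bigr => b _.
    by rewrite wedge_xy scale_block_mx !scaler0 scalerN.
  under eq_bigr do rewrite sum_block_mx sumrN.
  rewrite sum_block_mx Z sumrN -matrix_sum_delta -matrix_sum_delta_tr.
  by rewrite (Psk i _ ui) opprK.
have -> : \sum_a \sum_b \sum_s (partial i s (fun q => P i q a b) (foot u)
    * velocity u i ord0 s) *: wedge (basis_y a) (basis_y b) =
    block_mx 0 0 0 (W - W^T).
  transitivity (\sum_a \sum_b block_mx (0 : 'M[R]_N) (0 : 'M[R]_N) (0 : 'M[R]_N)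
      (W a b *: delta_mx a b - W a b *: delta_mx b a)).
    apply: eq_bigr => a _; apply: eq_bigr => b _.
    rewrite wedge_yy -scaler_suml scale_block_mx !scaler0 scalerBr.
    suff -> : \sum_s partial i s (fun q => P i q a b) (foot u)
        * velocity u i ord0 s = W a b by [].
    rewrite /W derive_dir_sum// summxE; apply: eq_bigr => s _.
    have ds : derivable A x (delta_mx ord0 s) by exact: diff_derivable.
    by rewrite mxE mulrC (derive_entry _ _ ds).
  under eq_bigr do rewrite sum_block_mx sumrB.
  by rewrite sum_block_mx Z sumrB -matrix_sum_delta -matrix_sum_delta_tr.
rewrite Wsk opprK scale_block_mx !scaler0 add_block_mx !addr0 add0r.
by rewrite scalerDr -scalerDl -[2^-1]mul1r -splitr scale1r.
Qed.

End tangent.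

Section transition.
Context {R : realType} {N : nat} (M : manifold R N).
Implicit Types (i j : chart M) (u : tangent_vector M).

Lemma mulmx_transition i j x (v : 'rV[R]_N) :
  (cod i `&` param i @^-1` dom j) x ->
  v *m 'J (coord j \o param i) x = 'D_v (coord j \o param i) x.
Proof.
by move=> xO; rewrite deriveEjacobian//; exact: transition_differentiable.
Qed.

Lemma mul_row_utri (v : 'rV[R]_(N + N)) (T S : 'M[R]_N) :
  v *m block_mx T S 0 T =
  row_mx (lsubmx v *m T) (lsubmx v *m S + rsubmx v *m T).
Proof. by rewrite -[v in LHS]hsubmxK mul_row_block mulmx0 addr0. Qed.

Lemma conj_utri (T S A D C : 'M[R]_N) a :
  (block_mx T S 0 T)^T *m block_mx 0 A A (D + a *: C) *m block_mx T S 0 T =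
  block_mx 0 (T^T *m A *m T) (T^T *m A *m T)
    ((S^T *m A + T^T *m D) *m T + T^T *m A *m S + a *: (T^T *m C *m T)).
Proof.
rewrite tr_block_mx trmx0 !mulmx_block !mulmx0 !mul0mx !add0r !addr0.
rewrite !mul0mx add0r (mulmxDr T^T) (addrA (S^T *m A)) [in LHS]mulmxDl.
by rewrite -scalemxAr -scalemxAl addrA (addrC (T^T *m A *m S)).
Qed.

(** The chart change of the tangent bundle is the tangent map
    [(x, y) |-> (f x, 'D_y f x)] of the one of the base; the block above the
    diagonal differentiates ['D_y f x] in [x]. *)
Lemma tangent_transition i j u : dom i (foot u) -> dom j (foot u) ->
  transition_jacobian (M := tangent_bundle M) i j u =
  block_mx (transition_jacobian i j (foot u))
    ('J ('D_(velocity u i) (coord j \o param i)) (coord i (foot u)))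
    0 (transition_jacobian i j (foot u)).
Proof.
move=> ui uj; set f := coord j \o param i; set x := coord i (foot u).
have Oo : open (cod i `&` param i @^-1` dom j) := @overlap_open _ _ M i j.
have Ox : (cod i `&` param i @^-1` dom j) x := overlap_coord ui uj.
have fs : smooth_on (cod i `&` param i @^-1` dom j) f := transition_smooth i j.
set z := tcoord i u.
have zl : lsubmx z = x by rewrite /z /tcoord row_mxKl.
have zr : rsubmx z = velocity u i by rewrite /z /tcoord row_mxKr.
have Uz : (cod i `&` param i @^-1` dom j) (lsubmx z) by rewrite zl.
apply: mul_rV_inj => v.
have dT : differentiable (tcoord j \o tparam i) z.
  apply: (@transition_differentiable _ _ (tangent_bundle M) i j z).
  exact: (@overlap_coord _ _ (tangent_bundle M) i j u).
rewrite -[LHS](deriveEjacobian v dT).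
pose g1 (y : 'rV[R]_(N + N)) := f (lsubmx y).
pose g2 (y : 'rV[R]_(N + N)) := 'D_(rsubmx y) f (lsubmx y).
have d1 : derivable g1 z v := smooth_derivable (smooth_lsub_comp Oo fs) Uz.
have d2 : derivable g2 z v := smooth_derivable (smooth_fibre_derive Oo fs) Uz.
transitivity ('D_v (fun y => row_mx (g1 y) (g2 y)) z).
  apply: near_eq_derive; near=> y.
  have [yi yj] : (cod i `&` param i @^-1` dom j) (lsubmx y).
    near: y; apply: (open_nbhs_nbhs (conj (lsub_open Oo) _)); exact: Uz.
  rewrite /= /tcoord [foot _]/= velocity_tangent_of//; last exact: param_dom.
  by rewrite /transition_jacobian paramK// mulmx_transition.
apply: etrans (derive_row_mx d1 d2) _.
have E1 := derive_lsub_comp fs v Uz.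
have E2 := derive_fibre_derive Oo fs v Uz.
rewrite zl in E1; rewrite zl zr in E2.
have dfy : differentiable ('D_(velocity u i) f) x.
  exact: smooth_diff (smooth_derive _ fs) Ox.
rewrite E1 E2 mul_row_utri /transition_jacobian.
have F1 := mulmx_transition (lsubmx v) Ox.
have F2 := mulmx_transition (rsubmx v) Ox.
have F3 := deriveEjacobian (lsubmx v) dfy.
exact: (f_equal2 (fun a b => row_mx a b) (esym F1)
  (etrans (addrC _ _) (f_equal2 +%R F3 (esym F2)))).
Unshelve. all: by end_near. Qed.

End transition.

Section lifted_transition.
Context {R : realType} {N : nat} (U U' : set 'rV[R]_N).
Hypotheses (Uo : open U).
Variable (f : 'rV[R]_N -> 'rV[R]_N).
Hypotheses (fs : smooth_on U f) (fU : forall x, U x -> U' (f x)).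

Lemma smooth_jacobian : smooth_on U (fun x => 'J f x).
Proof.
apply: (smooth_mx Uo) => a b.
apply: (@smooth_ext _ _ _ Uo _ (fun x => 'D_(delta_mx ord0 a) f x ord0 b)).
  move=> x Ux; rewrite (deriveEjacobian _ (smooth_diff fs Ux)).
  by rewrite -rowE mxE.
exact: (smooth_entry Uo ord0 b (smooth_derive _ fs)).
Qed.

Lemma derive_jacobian x y : U x ->
  'D_y (fun x => 'J f x) x = 'J ('D_y f) x.
Proof.
move=> Ux; apply: mul_rV_inj => v.
have dJ : derivable (fun x => 'J f x) x y := smooth_derivable smooth_jacobian Ux.
have dfy : differentiable ('D_y f) x := smooth_diff (smooth_derive y fs) Ux.
apply: etrans (esym (derive_cmulmx v dJ)) _.
apply: etrans _ (deriveEjacobian v dfy).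
apply: etrans _ (derive_comm_mx y v Uo fs Ux).
apply: near_eq_derive; near=> w.
have Uw : U w by near: w; exact: open_nbhs_nbhs.
exact: esym (deriveEjacobian v (smooth_diff fs Uw)).
Unshelve. all: by end_near. Qed.

(** The lower right blocks match because ['D_(y *m T) A'] at [f x] is the
    derivative along [y] of the transformation law of [A], and the derivative
    of the Jacobian along [y] is the upper right block of [Tz]. *)
Lemma lifted_transition (A A' : 'rV[R]_N -> 'M[R]_N) (k k' : 'rV[R]_N -> R)
    (X Y X' Y' : 'rV[R]_N -> 'rV[R]_N) (z : 'rV[R]_(N + N)) :
  let x := lsubmx z in let y := rsubmx z in
  let T := 'J f x in let Tz := block_mx T ('J ('D_y f) x) 0 T in
  smooth_on U A -> smooth_on U' A' -> U x ->
  (forall x, U x -> A' (f x) = ('J f x)^T *m A x *m 'J f x) ->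
  k' (f x) = k x -> X' (f x) = X x *m T -> Y' (f x) = Y x *m T ->
  lifted A' k' X' Y' (row_mx (f x) (y *m T)) =
  Tz^T *m lifted A k X Y z *m Tz.
Proof.
move=> x y T Tz As A's Ux AE kE XE YE.
have df : differentiable f x := smooth_diff fs Ux.
have dA : derivable A x y := smooth_derivable As Ux.
have dJ : derivable (fun x => 'J f x) x y := smooth_derivable smooth_jacobian Ux.
have dJt := derivable_trmx dJ.
have dJA := derivable_mulmx dJt dA.
set S := 'J ('D_y f) x in Tz *.
have DE : 'D_(y *m T) A' (f x) =
    (S^T *m A x + T^T *m 'D_y A x) *m T + T^T *m A x *m S.
  rewrite -(deriveEjacobian y df).
  apply: etrans (esym (derive_comp y df (smooth_diff A's (fU Ux)))) _.
  transitivity ('D_y (fun x => ('J f x)^T *m A x *m 'J f x) x).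
    apply: near_eq_derive; near=> w; apply: AE.
    by near: w; exact: open_nbhs_nbhs.
  apply: etrans (derive_mulmx dJA dJ) _.
  by rewrite (derive_mulmx dJt dA) (derive_trmx dJ) derive_jacobian.
rewrite /lifted row_mxKl row_mxKr DE (AE x Ux) kE XE YE wedge_mulmx.
apply: esym; exact: conj_utri.
Unshelve. all: by end_near. Qed.

End lifted_transition.

(** * The deformed tensor on the tangent bundle *)

Lemma eq_jacobiator (R : realType) n (A A' : 'rV[R]_n -> 'M[R]_n) x u v w :
  (\near x, A x = A' x) -> jacobiator A x u v w = jacobiator A' x u v w.
Proof.
move=> AA'; have E := nbhs_singleton AA'.
have D y : 'D_y A x = 'D_y A' x by exact: near_eq_derive.
by rewrite /jacobiator /jacobiator_term E !D.
Qed.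

Section deformation.
Context {R : realType} {N : nat} (M : manifold R N).
Variables (pi : bivector_components M) (c : M -> R) (lambda : R).
Variables (X Y : vector_components M).
Hypotheses (piP : is_poisson_tensor pi) (cP : is_casimir pi c).
Hypotheses (XP : is_poisson_vector_field pi X).
Hypotheses (YP : is_poisson_vector_field pi Y).

Let Q : bivector_components (tangent_bundle M) := fun i u =>
  tangent_lift pi i u + (lambda * c (bundle_proj u))
    *: wedge (vertical_lift X i u) (vertical_lift Y i u).

Let Qc (i : chart M) := lifted (pi i \o param i)
  (fun x => lambda * c (param i x)) (X i \o param i) (Y i \o param i).

Let pib : is_bivector_field pi. Proof. by case: piP. Qed.

Lemma deformation_coord (i : chart M) (u : tangent_vector M) :
  dom i (foot u) -> Q i u = Qc i (tcoord i u).
Proof.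
move=> ui; rewrite /Q (tangent_liftE pib ui) !vertical_liftE wedge_row0.
rewrite scale_block_mx !scaler0 add_block_mx !addr0 /Qc /lifted /tcoord.
by rewrite row_mxKl row_mxKr /= (coordK ui).
Qed.

Lemma deformation_param (i : chart M) z :
  tcod i z -> Q i (tparam i z) = Qc i z.
Proof.
move=> zi; rewrite deformation_coord ?tparamK//; exact: param_dom.
Qed.

Let pis i : smooth_on (cod i) (pi i \o param i).
Proof. by case: pib. Qed.

Let pisk i x : cod i x -> ((pi i \o param i) x)^T = - (pi i \o param i) x.
Proof. by move=> xi; case: pib => + _ _; apply; exact: param_dom. Qed.

Let Xs i : smooth_on (cod i) (X i \o param i).
Proof. by case: XP => -[]. Qed.

Let Ys i : smooth_on (cod i) (Y i \o param i).
Proof. by case: YP => -[]. Qed.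

Let ks (i : chart M) : smooth_on (cod i) (fun x => lambda * c (param i x)).
Proof.
have Uo := @cod_open _ _ M i; have [cs _] := cP.
exact: (smoothM Uo (smooth_cst Uo _) (cs i)).
Qed.

Lemma poisson_field_coord (Z : vector_components M) i x :
  is_poisson_vector_field pi Z -> cod i x ->
  'D_((Z i \o param i) x) (pi i \o param i) x =
  ('J (Z i \o param i) x)^T *m (pi i \o param i) x
  + (pi i \o param i) x *m 'J (Z i \o param i) x.
Proof.
move=> [_ ZL] xi; have := ZL i _ (param_dom xi); rewrite /lie_derivative paramK//.
by move/eqP; rewrite -addrA -opprD subr_eq0 => /eqP.
Qed.

Lemma vector_field_transition (Z : vector_components M) (i j : chart M) x :
  is_vector_field Z -> (cod i `&` param i @^-1` dom j) x ->
  (Z j \o param j) ((coord j \o param i) x) =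
  (Z i \o param i) x *m 'J (coord j \o param i) x.
Proof.
move=> [Ztr _] [xi xj]; rewrite /= coordK// (Ztr i j _ (param_dom xi) xj).
by rewrite /transition_jacobian paramK.
Qed.

Lemma deformation_transition (i j : chart M) (u : tangent_vector M) :
  dom i (foot u) -> dom j (foot u) ->
  Q j u = (transition_jacobian (M := tangent_bundle M) i j u)^T *m Q i u
    *m transition_jacobian (M := tangent_bundle M) i j u.
Proof.
move=> ui uj; rewrite (deformation_coord ui) (deformation_coord uj).
rewrite (tangent_transition ui uj) {1}/tcoord (velocity_law ui uj).
have Ox := overlap_coord ui uj.
have fU x : (cod i `&` param i @^-1` dom j) x -> cod j ((coord j \o param i) x).
  by move=> [_ xj]; exact: coord_cod.
have zl : lsubmx (tcoord i u) = coord i (foot u) by rewrite /tcoord row_mxKl.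
have zr : rsubmx (tcoord i u) = velocity u i by rewrite /tcoord row_mxKr.
have := @lifted_transition _ _ _ _ (@overlap_open _ _ M i j) _
  (transition_smooth i j) fU (pi i \o param i) (pi j \o param j)
  (fun x => lambda * c (param i x)) (fun x => lambda * c (param j x))
  (X i \o param i) (Y i \o param i) (X j \o param j) (Y j \o param j)
  (tcoord i u).
rewrite /= zl zr (coordK ui); apply.
- by apply: smooth_sub (pis i) => x [].
- exact: pis.
- by split=> //; exact: coord_cod.
- move=> x [xi xj]; case: pib => _ pitr _; rewrite coordK//.
  by rewrite (pitr i j _ (param_dom xi) xj) /transition_jacobian paramK.
- by rewrite (coordK uj).
- by have := vector_field_transition XP.1 Ox; rewrite /= (coordK ui).
- by have := vector_field_transition YP.1 Ox; rewrite /= (coordK ui).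
Qed.

Lemma deformation_bivector : is_bivector_field Q.
Proof.
split=> [i u ui|i j u ui uj|i].
- rewrite (deformation_coord ui).
  apply: (lifted_skew (@cod_open _ _ M i) _ _ _ (pis i) (@pisk i)).
  by rewrite /tcoord /= row_mxKl; exact: coord_cod.
- exact: deformation_transition.
- apply: (@smooth_ext _ _ _ (@tcod_open _ _ M i) _ (Qc i)).
    by move=> z zi; rewrite /= deformation_param.
  exact: (smooth_lifted (@cod_open _ _ M i) (pis i) (@ks i) (@Xs i) (@Ys i)).
Qed.

Lemma deformation_jacobi (i : chart M) z u v w : tcod i z ->
  jacobiator (Q i \o @tparam _ _ M i) z u v w = 0.
Proof.
move=> zi; have Uo := @cod_open _ _ M i.
have -> : jacobiator (Q i \o @tparam _ _ M i) z u v w =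
    jacobiator (Qc i) z u v w.
  apply: eq_jacobiator; near=> y; apply: deformation_param.
  by near: y; apply: open_nbhs_nbhs; split=> //; exact: tcod_open.
have [_ piJ] := (poisson_tensorP pi).1 piP.
apply: (lifted_jacobi Uo (pis i) (@ks i) (@Xs i) (@Ys i) (@pisk i) (piJ i)).
- move=> x xi a; have [cs _] := cP.
  have dc : derivable (c \o param i) x (a *m pi i (param i x)).
    exact: smooth_derivable (cs i) xi.
  apply: etrans (deriveZ lambda dc) _.
  by rewrite casimir_local// scaler0.
- by move=> x xi; exact: poisson_field_coord.
- by move=> x xi; exact: poisson_field_coord.
- exact: zi.
Unshelve. all: by end_near. Qed.

End deformation.

Theorem theorem7 (R : realType) (N : nat) (M : manifold R N)
    (pi : bivector_components M) (c : M -> R) (lambda : R)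
    (X Y : vector_components M) :
  is_poisson_tensor pi ->
  is_casimir pi c ->
  is_poisson_vector_field pi X ->
  is_poisson_vector_field pi Y ->
  @is_poisson_tensor R (N + N) (tangent_bundle M)
    (fun i u => tangent_lift pi i u
       + (lambda * c (bundle_proj u))
           *: wedge (vertical_lift X i u) (vertical_lift Y i u)).
Proof.
move=> piP cP XP YP; apply/poisson_tensorP; split.
  exact: deformation_bivector.
by move=> i z zi u v w; exact: deformation_jacobi.
Qed.
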